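(* Consider the urban-system (MFD) model with a transit outside option described in the context. Suppose $\mu_f<\lambda$ and users choose between two modes: traveling by car through an urban system characterized by a macroscopic fundamental diagram (MFD) $n\mapsto\mu(n)$ satisfying the following two properties: (Property 1) there exists a critical vehicle accumulation level $n_c$ beyond which additional vehicles reduce total outflow; (Property 2) for vehicle accumulations up to $n_c$, the throughput is linear in $n$ (free-flow conditions), achieving its maximum $\mu_f$ at $n=n_c$; and using public transit with fixed cost $z_T$, where $z_T\ge z_C$. Then, under the revenue-optimal dynamic tolling policy, the system always (throughout the interval during which car users exit the system) operates at the critical vehicle accumulation level $n_c$, corresponding to the throughput-maximizing capacity $\mu_f$.
   Context: Urban system model. A continuum of users of total mass $\Lambda>0$ has desired exit times $t^*$ from the urban system uniformly distributed over $[t_1,t_2]$, with desired rate $\lambda=\Lambda/(t_2-t_1)$. Each user travels either by car through the urban system or by public transit. The system has a state-dependent outflow capacity (throughput) $\mu(n)$, where $n$ is the number of vehicles in the system; the function $n\mapsto \mu(n)$ is the MFD. All car trips have the same length $D$, the system speed at accumulation $n$ is $v(n)=D\mu(n)/n$, and so the delay over free flow when the accumulation is $n$ is $w(n) = \frac{n}{\mu(n)}-\frac{n_c}{\mu_f}\ge 0$ (zero for $n\le n_c$). With $n(t)$ the number of vehicles in the system at time $t$, cars exit at rate $\mu(n(t))$ and the waiting delay is $w(t)=w(n(t))$. Costs are normalized by the value of waiting time. A car user with desired exit time $t^*$ who exits at time $t$ pays $$c(t,t^* ) = z_C + w(t) + e\,(t^*-t)_+ + L\,(t-t^* )_+ +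 \tau(t),$$ where $z_C$ is the free-flow cost of a car trip, $0<e<1$ and $L>0$ are the earliness and lateness penalties, and $\tau(t)\ge0$ is the toll. A transit user pays the fixed cost $z_T$ and arrives at the desired time. Equilibrium: given the toll, every user chooses a mode and, if traveling by car, an exit time so as to minimize own cost given $w(\cdot)$, and no user has an incentive to deviate; car users exit in order of their desired exit times. When users are indifferent between car and transit, ties are broken in favor of higher-revenue outcomes. Revenue: with $[t_A,t_D]$ the interval over which car users exit at equilibrium under the policy $\tau(\cdot)$, $R(\tau(\cdot))=\int_{t_A}^{t_D}\mu(n(t))\,\tau(t)\,dt$. The revenue-optimal dynamic tolling policy maximizes $R$ over all (possibly time-varying) toll functions $\tau(\cdot)$.
   Formalization: If z_T = z_C all policies earn zero, so only some revenue-optimal policy is shown to operate at n_c; for z_T > z_C every one does. There ''always'' means at almost every time of the exit interval and wherever n(t) is continuous, since null sets of times do not affect revenue. *)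

(* Defs.v *)
From HB Require Import structures.
From mathcomp Require Import all_boot all_order all_algebra.
From mathcomp Require Import all_classical all_reals all_analysis.

Set Implicit Arguments.
Unset Strict Implicit.
Unset Printing Implicit Defensive.

Import Order.TTheory GRing.Theory Num.Theory.
Import numFieldNormedType.Exports.

Local Open Scope classical_set_scope.
Local Open Scope ring_scope.

(* Costs are expressed in units of waiting time. *)
Record urban_model (R : realType) := UrbanModel {
  mass : R;             (* total mass Lambda of users *)
  t1 : R;
  t2 : R;
  mfd : R -> R;         (* throughput mu(n); only n >= 0 is meaningful *)
  n_c : R;
  mu_f : R;
  z_C : R;
  z_T : R;
  earliness : R;
  lateness : R
}.

Definition desired_rate (R : realType) (m : urban_model R) : R :=
  mass m / (t2 m - t1 m).

Record standing_assumptions (R : realType) (m : urban_model R) : Prop := {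
  mass_gt0 : 0 < mass m;
  t1_lt_t2 : t1 m < t2 m;
  n_c_gt0 : 0 < n_c m;
  mu_f_gt0 : 0 < mu_f m;
  mfd_ge0 : forall n, 0 <= n -> 0 <= mfd m n;
  earliness_gt0 : 0 < earliness m;
  earliness_lt1 : earliness m < 1;
  lateness_gt0 : 0 < lateness m
}.

(* Strict decrease is required only as long as there is outflow left to lose:
   the MFD may reach 0 at a jam accumulation, and then stays at 0. *)
Definition congested_beyond_critical (R : realType) (m : urban_model R) : Prop :=
  forall n n' : R, n_c m <= n -> n < n' ->
    (0 < mfd m n -> mfd m n' < mfd m n) /\ (mfd m n = 0 -> mfd m n' = 0).

Definition free_flow_below_critical (R : realType) (m : urban_model R) : Prop :=
  forall n : R, 0 <= n <= n_c m -> mfd m n = mu_f m * (n / n_c m).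

(* w(n) = n / mu(n) - n_c / mu_f.  The quotient is 0/0 at n = 0, where the
   delay is 0, and is infinite in gridlock (n > 0 with no outflow). *)
Definition delay (R : realType) (m : urban_model R) (n : R) : \bar R :=
  if n == 0 then 0%E
  else if mfd m n == 0 then +oo%E
  else (n / mfd m n - n_c m / mu_f m)%:E.

(* A distributional description of what the continuum of users does.  Among
   the users with desired exit time s in [t1, t2], the fraction [car_share s]
   drives, exiting at [exit_time s], and the others use transit; [exit_time s]
   is irrelevant when [car_share s = 0]. *)
Record outcome (R : realType) := Outcome {
  accumulation : R -> R;
  car_share : R -> R;
  exit_time : R -> R;
  t_A : R;
  t_D : R
}.

Definition exit_rate (R : realType) (m : urban_model R) (o : outcome R) (t : R)
  : R := mfd m (accumulation o t).

(* Desired exit times of the car users who have exited by time t. *)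
Definition exited_by (R : realType) (m : urban_model R) (o : outcome R) (t : R)
  : set R :=
  [set s | [/\ t1 m <= s <= t2 m, 0 < car_share o s & exit_time o s <= t]].

Definition cost (R : realType) (m : urban_model R) (tau : R -> R)
    (o : outcome R) (t s : R) : \bar R :=
  ((z_C m)%:E + delay m (accumulation o t)
   + (earliness m * Num.max 0 (s - t))%:E
   + (lateness m * Num.max 0 (t - s))%:E + (tau t)%:E)%E.

(* [fl_first] and [fl_last] make [t_A, t_D] the smallest interval containing
   all exits (up to a null set of users); nothing prevents gaps inside it.
   [fl_conservation]: the mass of car users who have exited by time t is the
   integral up to t of the exit rate mu(n). *)
Record feasible (R : realType) (m : urban_model R) (o : outcome R) : Prop := {
  fl_acc_ge0 : forall t, 0 <= accumulation o t;
  fl_interval : t_A o <= t_D o;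
  fl_outside : forall t, ~ (t_A o <= t <= t_D o) -> accumulation o t = 0;
  fl_measurable_rate : measurable_fun setT (exit_rate m o);
  fl_first : forall t, t_A o < t < t_D o ->
    (0 < \int[lebesgue_measure]_(x in `[t_A o, t]) (exit_rate m o x)%:E)%E;
  fl_last : forall t, t_A o < t < t_D o ->
    (0 < \int[lebesgue_measure]_(x in `[t, t_D o]) (exit_rate m o x)%:E)%E;
  fl_share : forall s, t1 m <= s <= t2 m -> 0 <= car_share o s <= 1;
  fl_measurable_share : measurable_fun `[t1 m, t2 m] (car_share o);
  fl_order : forall s s', t1 m <= s <= t2 m -> t1 m <= s' <= t2 m ->
    0 < car_share o s -> 0 < car_share o s' ->
    s < s' -> exit_time o s <= exit_time o s';
  fl_conservation : forall t : R,
    (\int[lebesgue_measure]_(s in exited_by m o t)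
       (desired_rate m * car_share o s)%:E
     = \int[lebesgue_measure]_(x in `]-oo, t]) (exit_rate m o x)%:E)%E
}.

Record equilibrium (R : realType) (m : urban_model R) (tau : R -> R)
    (o : outcome R) : Prop := {
  eq_feasible : feasible m o;
  eq_exit_time : forall s, t1 m <= s <= t2 m -> 0 < car_share o s ->
    forall t, (cost m tau o (exit_time o s) s <= cost m tau o t s)%E;
  eq_car : forall s, t1 m <= s <= t2 m -> 0 < car_share o s ->
    (cost m tau o (exit_time o s) s <= (z_T m)%:E)%E;
  eq_transit : forall s, t1 m <= s <= t2 m -> car_share o s < 1 ->
    forall t, ((z_T m)%:E <= cost m tau o t s)%E
}.

Definition toll (R : realType) (tau : R -> R) : Prop :=
  measurable_fun setT tau /\ forall t, 0 <= tau t.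

Definition outcome_revenue (R : realType) (m : urban_model R) (tau : R -> R)
    (o : outcome R) : \bar R :=
  (\int[lebesgue_measure]_(t in `[t_A o, t_D o])
     (exit_rate m o t * tau t)%:E)%E.

(* Indifferent users break ties in favor of revenue, so a toll is worth the
   best of its equilibria (-oo if it has none). *)
Definition revenue (R : realType) (m : urban_model R) (tau : R -> R) : \bar R :=
  ereal_sup [set outcome_revenue m tau o | o in equilibrium m tau].

Definition tie_broken_equilibrium (R : realType) (m : urban_model R)
    (tau : R -> R) (o : outcome R) : Prop :=
  equilibrium m tau o /\ outcome_revenue m tau o = revenue m tau.

Definition revenue_optimal (R : realType) (m : urban_model R) (tau : R -> R)
  : Prop :=
  toll tau /\ forall tau', toll tau' -> (revenue m tau' <= revenue m tau)%E.

(* Main.v *)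
(* An equilibrium exits at rate at most [mu_f]; call a driver early (late) when
   he exits before (after) his desired time.  Since [mu_f] is below the desired
   rate, cumulative exits meet the line [lambda * (t - t1)] at a single time [b]:
   at each earlier time somebody has already exited ahead of his desired time.
   Chaining the no-deviation inequalities of these drivers from one to the next
   shows that each of them keeps a rent large enough to force the toll paid at
   [t < b] below [z_T - z_C - e * (b - t)].  Mirrored in time, the toll paid at
   [t > a] is at most [z_T - z_C - L * (t - a)], where [a >= b] plays the role
   of [b] for the exits still to come.  The number of exits before [b] and after
   [a] is prescribed, so by a bathtub argument revenue is largest when exits
   occur at rate [mu_f] exactly on a window [b - u, a + v], and only then (up to
   a null set) if [z_C < z_T].  This leaves a concave quadratic function of
   [(u, v)], whose maximum is attained by an equilibrium exiting at rate [mu_f]: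
   everybody desiring to exit before [b] or after [a] drives, and a fraction
   [mu_f / lambda] of the others drives and exits on time. *)
Require Import Defs.
From HB Require Import structures.
From mathcomp Require Import all_boot all_order all_algebra.
From mathcomp Require Import all_classical all_reals all_analysis.
From mathcomp Require Import measurable_realfun ring lra.
Set Implicit Arguments.
Unset Strict Implicit.
Import Order.TTheory GRing.Theory Num.Theory.
Import numFieldNormedType.Exports.
Local Open Scope classical_set_scope.
Local Open Scope ring_scope.

Local Notation mu := lebesgue_measure.

(** * Tolls paid by early and late users *)

(** [t] is the exit time and [s] the desired one. Keeping both penalties as arguments lets a
    reversal of time swap them. *)
Definition sched {R : realType} (e L t s : R) : R :=
  e * Num.max 0 (s - t) + L * Num.max 0 (t - s).

Lemma maxr_case {R : realType} (x : R) :
  (0 <= x /\ Num.max 0 x = x) \/ (x <= 0 /\ Num.max 0 x = 0).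
Proof.
by case: (lerP 0 x) => h; [left; split=> //|right; split=> //; exact: ltW].
Qed.

(** [S], [T] and [G] stand for the drivers, their exit times, and delay plus toll. A driver could
    take the exit of a later-desiring driver who leaves early, saving [e] per unit of desired time.
    Rents, [D] minus cost, thus fall at slope at least [e] along the chain of early drivers; being
    nonnegative where the chain passes [b], they are at least [e * (b - s0)] at [s0]. *)
Lemma early_price_le {R : realType} (e L D lo hi b : R) (S : set R)
    (T G : R -> R) :
  0 < e -> 0 < L ->
  (forall s, S s -> lo <= s <= hi) ->
  (forall s s', S s -> S s' -> s < s' -> T s <= T s') ->
  (forall s s', S s -> S s' ->
    G (T s) + sched e L (T s) s <= G (T s') + sched e L (T s') s) ->
  (forall s, S s -> G (T s) + sched e L (T s) s <= D) ->
  (forall t, lo <= t < b -> exists s, [/\ S s, t < s & T s <= t]) ->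
  forall s, S s -> T s < b -> G (T s) <= D - e * (b - T s).
Proof.
move=> e0 L0 bnd mono ic ir prog.
have rent s0 : S s0 -> s0 < b ->
    e * (b - s0) <= D - G (T s0) - sched e L (T s0) s0.
  move=> S0 s0b; set v := D - _ - _.
  (* [D - v] is the cost of [s0]. [Y] holds the desired times reached by the chain: every driver's
     exit would cost a user desiring [y] at least [D - v + e * (y - s0)], and the rent [v] covers
     the increase. *)
  pose Y := [set y | [/\ s0 <= y <= hi, e * (y - s0) <= v & forall s', S s' ->
    D - v + e * (y - s0) <= G (T s') + sched e L (T s') y]].
  have Y0 : Y s0.
    have /andP[_ hs] := bnd _ S0.
    split; first by rewrite lexx hs.
      by rewrite subrr mulr0 /v; have := ir _ S0; lra.
    move=> s' S'; have := ic _ _ S0 S'.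
    by rewrite /v; lra.
  have supY : has_sup Y.
    by split; [exists s0|exists hi => y [/andP[]]].
  have Ysup : Y (sup Y).
    have s0y : s0 <= sup Y by apply: ub_le_sup => //; case: supY.
    have yhi : sup Y <= hi by apply: ge_sup; [exists s0|move=> y [/andP[]]].
    split; first by rewrite s0y yhi.
    - rewrite leNgt; apply/negP => h.
      have [|y' [_ hv _] hy] := @sup_adherent _ Y ((e * (sup Y - s0) - v) / e) _ supY.
        by rewrite divr_gt0 ?subr_gt0.
      have : e * ((e * (sup Y - s0) - v) / e) = e * (sup Y - s0) - v by field; lra.
      nra.
    - move=> s' S'; rewrite leNgt; apply/negP => h.
      set d := _ - _ + _ in h.
      set r := _ + sched _ _ _ _ in h.
      (* Going down from [sup Y] to [y'], the left side drops at rate [e] and the right side rises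
         at rate at most [L], so a violation of size [d - r] persists at distances below
         [(d - r) / (e + L)]. *)
      have [|y' Yy' hy] := @sup_adherent _ Y ((d - r) / (e + L)) _ supY.
        by rewrite divr_gt0 ?subr_gt0 ?addr_gt0.
      have : (e + L) * ((d - r) / (e + L)) = d - r by field; lra.
      have y'le : y' <= sup Y by apply: ub_le_sup => //; case: supY.
      case: Yy' => _ _ /(_ _ S').
      move: h hy; rewrite /d /r /sched.
      set q := (_ / (e + L)).
      case: (maxr_case (sup Y - T s')) => -[? ->];
      case: (maxr_case (T s' - sup Y)) => -[? ->];
      case: (maxr_case (y' - T s')) => -[? ->];
      case: (maxr_case (T s' - y')) => -[? ->]; nra.
  (* Once [sup Y] reaches [b] the rent bound follows. Otherwise some driver desiring a time beyond
     [sup Y] is already out, and his own no-deviation inequalities place him in [Y], a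
     contradiction. *)
  have [yb|by_] := ltP (sup Y) b; last first.
    by case: Ysup => _ hv _; nra.
  case: (Ysup) => /andP[ys0 yhi] hv hG.
  have /andP[los0 _] := bnd _ S0.
  have [|s [Ss ys Ts]] := prog (sup Y); first by rewrite yb (le_trans los0).
  suff Ys : Y s.
    have : s <= sup Y by apply: ub_le_sup => //; case: supY.
    by rewrite leNgt ys.
  have /andP[_ shi] := bnd _ Ss.
  have := hG _ Ss; have := ir _ Ss.
  rewrite /sched.
  have -> : Num.max 0 (s - T s) = s - T s by apply/max_idPr; lra.
  have -> : Num.max 0 (T s - s) = 0 by apply/max_idPl; lra.
  have -> : Num.max 0 (sup Y - T s) = sup Y - T s by apply/max_idPr; lra.
  have -> : Num.max 0 (T s - sup Y) = 0 by apply/max_idPl; lra.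
  move=> h1 h2.
  split.
  - by rewrite shi (le_trans ys0) ?ltW.
  - nra.
  - move=> s' S'; have := ic _ _ Ss S'; rewrite [sched e L (T s) s]/sched.
    have -> : Num.max 0 (s - T s) = s - T s by apply/max_idPr; lra.
    have -> : Num.max 0 (T s - s) = 0 by apply/max_idPl; lra.
    nra.
(* For [s < b] the rent of [s] gives the bound; for [s >= b] participation alone does, since the
   earliness cost already exceeds [e * (b - T s)]. *)
have early s : S s -> T s < b -> T s <= s -> G (T s) <= D - e * (b - T s).
  move=> Ss Tb Ts.
  have := ir _ Ss; have := rent _ Ss; rewrite /sched.
  have -> : Num.max 0 (s - T s) = s - T s by apply/max_idPr; lra.
  have -> : Num.max 0 (T s - s) = 0 by apply/max_idPl; lra.
  case: (ltP s b) => sb; first by move=> /(_ isT); nra.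
  by move=> _; nra.
move=> s Ss Tb; case: (leP (T s) s) => Ts; first exact: early.
have /andP[los _] := bnd _ Ss.
(* A late driver shares his exit time with an early one: [s < T s < s'] and [T s' <= T s], while the
   order of exits gives [T s <= T s']. *)
have [|s' [S' ts' Ts']] := prog (T s); first by rewrite Tb (le_trans los) ?ltW.
have E : T s' = T s.
  by apply/le_anti; rewrite Ts' mono // (lt_trans Ts).
by rewrite -E; apply: early => //; rewrite E // ltW.
Qed.

(** Reversing time swaps [e] and [L] and reduces this to [early_price_le]; the order of exits
    survives because desired and exit times both change sign. *)
Lemma late_price_le {R : realType} (e L D lo hi a : R) (S : set R)
    (T G : R -> R) :
  0 < e -> 0 < L ->
  (forall s, S s -> lo <= s <= hi) ->
  (forall s s', S s -> S s' -> s < s' -> T s <= T s') ->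
  (forall s s', S s -> S s' ->
    G (T s) + sched e L (T s) s <= G (T s') + sched e L (T s') s) ->
  (forall s, S s -> G (T s) + sched e L (T s) s <= D) ->
  (forall t, a < t <= hi -> exists s, [/\ S s, s < t & t <= T s]) ->
  forall s, S s -> a < T s -> G (T s) <= D - L * (T s - a).
Proof.
move=> e0 L0 bnd mono ic ir prog s Ss aT.
have schedN t r : sched L e (- t) r = sched e L t (- r).
  by rewrite /sched addrC; congr (_ * Num.max 0 _ + _ * Num.max 0 _); ring.
have bnd' r : S (- r) -> - hi <= r <= - lo.
  by move=> /bnd; rewrite lerNr lerNl andbC.
have mono' r r' : S (- r) -> S (- r') -> r < r' -> - T (- r) <= - T (- r').
  by move=> Sr Sr' rr'; rewrite lerN2; apply: mono => //; rewrite ltrN2.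
have ic' r r' : S (- r) -> S (- r') ->
    G (- - T (- r)) + sched L e (- T (- r)) r <=
    G (- - T (- r')) + sched L e (- T (- r')) r.
  by move=> Sr Sr'; rewrite !schedN !opprK; exact: ic.
have ir' r : S (- r) -> G (- - T (- r)) + sched L e (- T (- r)) r <= D.
  by move=> Sr; rewrite schedN !opprK; exact: ir.
have prog' t : - hi <= t < - a -> exists r, [/\ S (- r), t < r & - T (- r) <= t].
  move=> /andP[ht ta].
  have [|r [Sr rt tT]] := prog (- t); first by rewrite ltrNr ta lerNl.
  by exists (- r); rewrite !opprK; split=> //; [rewrite ltrNr|rewrite lerNl].
have := @early_price_le R L e D (- hi) (- lo) (- a) [set r | S (- r)]
  (fun r => - T (- r)) (fun t => G (- t)) L0 e0 bnd' mono' ic' ir' prog' (- s).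
by rewrite /= !opprK ltrN2 (addrC (T s)) => H; exact: H.
Qed.

(** * Image of a density under a monotone map *)

(** The pushforward under [g] of the measure with density [f], packaged as a measure so that
    uniqueness of measures applies. *)
Lemma image_density_measure {R : realType} (f g : R -> R) :
  measurable_fun [set: R] f -> (forall x, 0 <= f x) -> measurable_fun [set: R] g ->
  exists m : {measure set R -> \bar R},
    forall A, m A = (\int[lebesgue_measure]_(x in g @^-1` A) (f x)%:E)%E.
Proof.
move=> mf f0 mg.
pose m0 (A : set R) := (\int[lebesgue_measure]_(x in g @^-1` A) (f x)%:E)%E.
have m00 : m0 set0 = 0%E by rewrite /m0 preimage_set0 integral_set0.
have m0ge A : (0 <= m0 A)%E by apply: integral_ge0 => x _; rewrite lee_fin.
have mpre A : measurable A -> measurable (g @^-1` A).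
  by move=> mA; rewrite -[X in measurable X]setTI; exact: mg.
have m0s : semi_sigma_additive m0.
  move=> F mF tF mUF; rewrite /m0 preimage_bigcup ge0_integral_bigcup//=.
  - by apply: is_cvg_ereal_nneg_natsum_cond => // n _ _; exact: m0ge.
  - by move=> n; exact: mpre.
  - by apply/measurable_EFinP; apply: measurable_funTS.
  - by move=> x _; rewrite lee_fin.
  - move=> i j _ _ [x [Fi Fj]]; exact: (tF i j I I (ex_intro _ (g x) (conj Fi Fj))).
pose M := isMeasure.Build _ R R m0 m00 m0ge m0s.
by exists (HB.pack_for {measure set R -> \bar R} m0 M).
Qed.

(** Both sides are measures in [A], the right one being a pushforward under the identity. They agree
    and are finite on the closed left rays, a pi-system that generates the Borel sets and exhausts
    the line. *)
Lemma image_density_unique {R : realType} (f h g : R -> R) :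
  measurable_fun [set: R] f -> (forall x, 0 <= f x) ->
  measurable_fun [set: R] h -> (forall x, 0 <= h x) ->
  measurable_fun [set: R] g ->
  (forall t : R, \int[lebesgue_measure]_(x in g @^-1` `]-oo, t]) (f x)%:E =
             \int[lebesgue_measure]_(x in `]-oo, t]) (h x)%:E)%E ->
  (forall t : R, \int[lebesgue_measure]_(x in `]-oo, t]) (h x)%:E < +oo)%E ->
  forall A : set R, measurable A ->
  (\int[lebesgue_measure]_(x in g @^-1` A) (f x)%:E =
   \int[lebesgue_measure]_(x in A) (h x)%:E)%E.
Proof.
move=> mf f0 mh h0 mg fh hoo A mA.
have [m1 E1] := image_density_measure mf f0 mg.
have [m2 E2] := image_density_measure mh h0 (@measurable_id _ R setT).
rewrite -E1 -[RHS]E2.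
apply: (measure_unique [set B : set R | exists x : R, B = `]-oo, x]%classic]
  (fun n => `]-oo, n%:R]%classic)) => //.
- rewrite [LHS](RGenOInfty.measurableE R) eqEsubset; split => B.
    apply: smallest_sub; first exact: smallest_sigma_algebra.
    move=> _ [x ->]; rewrite -setCitvl -setTD; apply: sigma_algebraCD.
    by apply: sub_sigma_algebra; exists x.
  apply: smallest_sub; first exact: smallest_sigma_algebra.
  move=> _ [x ->]; rewrite -setCitvr -setTD; apply: sigma_algebraCD.
  by apply: sub_sigma_algebra; exists x.
- move=> _ _ [x ->] [y ->]; exists (Num.min x y).
  by apply/seteqP; split => z /=; rewrite !in_itv/= le_min => /andP.
- by move=> n; exists n%:R.
- apply/seteqP; split => // x _.
  exists (Num.bound `|x|) => //=; rewrite in_itv/= ltW//.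
  by rewrite (le_lt_trans (ler_norm x))// archi_boundP ?normr_ge0.
- by move=> _ [x ->]; rewrite E1 E2 fh.
- by move=> n; rewrite E1 fh.
Qed.

(* An order-preserving map pulls rays back to traces of intervals. *)
Lemma monotone_measurable {R : realType} (D : set R) (T : R -> R) :
  measurable D ->
  (forall s s', D s -> D s' -> s < s' -> T s <= T s') ->
  measurable_fun D T.
Proof.
move=> mD monoT.
have mray t : measurable (D `&` [set s | T s <= t]).
  pose I := [set r | exists2 s, D s /\ T s <= t & r <= s].
  have -> : D `&` [set s | T s <= t] = D `&` I.
    apply/seteqP; split => s /= [Ds].
      by move=> Ts; split => //; exists s.
    case=> s' [Ds' Ts']; rewrite le_eqVlt => /predU1P[->|ss'] //.
    by split => //; apply: le_trans Ts'; exact: monoT.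
  apply: measurableI => //; apply: is_interval_measurable.
  move=> x y [s Ds xs] [s' Ds' ys'] z /andP[xz zy].
  by exists s' => //; exact: le_trans ys'.
apply: (measurability (@RGenOInfty.G R)).
  exact: RGenOInfty.measurableE.
move=> _ [_ [t ->] <-].
have -> : D `&` T @^-1` `]t, +oo[ = D `\` (D `&` [set s | T s <= t]).
  apply/seteqP; split => s /=; rewrite in_itv/= andbT.
    by move=> [Ds tT]; split => // -[_]; rewrite leNgt tT.
  by move=> [Ds tT]; split => //; rewrite ltNge; apply/negP => ?; apply: tT.
exact: measurableD.
Qed.

(** Conservation is postulated on rays only; this carries it to every Borel set of exit times, as
    needed to see that no outflow occurs at times nobody chooses. *)
Lemma monotone_image_density {R : realType} (D : set R) (f h T : R -> R) :
  measurable D -> measurable_fun D f -> (forall s, D s -> 0 <= f s) ->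
  measurable_fun [set: R] h -> (forall t, 0 <= h t) ->
  (forall s s', D s -> D s' -> s < s' -> T s <= T s') ->
  (forall t : R, \int[lebesgue_measure]_(s in D `&` [set s | (T s <= t)%R]) (f s)%:E =
             \int[lebesgue_measure]_(x in `]-oo, t]) (h x)%:E)%E ->
  (\int[lebesgue_measure]_(s in D) (f s)%:E < +oo)%E ->
  forall A : set R, measurable A ->
  (\int[lebesgue_measure]_(s in D `&` T @^-1` A) (f s)%:E =
   \int[lebesgue_measure]_(x in A) (h x)%:E)%E.
Proof.
move=> mD mf f0 mh h0 monoT fh foo.
(* The value 0 that [T'] takes off [D] is harmless, since the extended density [f'] vanishes
   there. *)
pose T' := T \_ D.
have mT := monotone_measurable mD monoT.
have mT' : measurable_fun [set: R] T'.
  by apply/(measurable_restrictT _ mD).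
pose f' := f \_ D.
have mf' : measurable_fun [set: R] f'.
  by apply/(measurable_restrictT _ mD).
have f'0 s : 0 <= f' s.
  by rewrite /f' patchE; case: ifPn => // /set_mem /f0.
have E A : (\int[lebesgue_measure]_(s in T' @^-1` A) (f' s)%:E =
            \int[lebesgue_measure]_(s in D `&` T @^-1` A) (f s)%:E)%E.
  have -> : D `&` T @^-1` A = T' @^-1` A `&` D.
    apply/seteqP; split => s /= [].
      by move=> Ds TA; split => //; rewrite /T' patchE mem_set.
    by rewrite /T' patchE => + Ds; rewrite mem_set.
  rewrite [RHS]integral_mkcondr; apply: eq_integral => s _.
  by rewrite /f' !patchE; case: ifPn.
move=> A mA; rewrite -E.
apply: image_density_unique => //.
- move=> t; rewrite E -fh; congr integral.
- move=> t; rewrite -fh; apply: le_lt_trans foo.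
  apply: ge0_subset_integral => //.
  have -> : [set s | T s <= t] = T @^-1` `]-oo, t].
    by apply/seteqP; split => s /=; rewrite in_itv.
  exact: mT.
  exact/measurable_EFinP.
Qed.

(** * Bathtub inequality *)

Definition bounded_measurable {R : realType} (p q : R) (f : R -> R) : Prop :=
  measurable_fun [set: R] f /\ exists M, forall t, p <= t <= q -> `|f t| <= M.

Lemma bounded_measurable_integrable {R : realType} (p q : R) (f : R -> R) :
  bounded_measurable p q f -> mu.-integrable `[p, q] (EFin \o f).
Proof.
move=> [mf [M fM]]; apply: measurable_bounded_integrable => //.
- exact/compact_finite_measure/segment_compact.
- exact: measurable_funTS.
- exists M; split; first exact: num_real.
  move=> N MN t /=; rewrite in_itv/= => /fM h.
  exact: le_trans h (ltW MN).
Qed.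

Lemma bounded_measurable_cst {R : realType} (p q c : R) :
  bounded_measurable p q (fun=> c).
Proof. by split; [exact: measurable_cst|exists `|c|]. Qed.

Lemma bounded_measurableB {R : realType} (p q : R) (f g : R -> R) :
  bounded_measurable p q f -> bounded_measurable p q g ->
  bounded_measurable p q (fun t => f t - g t).
Proof.
move=> [mf [M fM]] [mg [N gN]]; split; first exact: measurable_funB.
exists (M + N) => t pq; apply: (le_trans (ler_normB _ _)).
by apply: lerD; [exact: fM|exact: gN].
Qed.

Lemma bounded_measurableM {R : realType} (p q : R) (f g : R -> R) :
  bounded_measurable p q f -> bounded_measurable p q g ->
  bounded_measurable p q (fun t => f t * g t).
Proof.
move=> [mf [M fM]] [mg [N gN]]; split; first exact: measurable_funM.
exists (M * N) => t pq; rewrite normrM.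
by apply: ler_pM => //; [exact: fM|exact: gN].
Qed.

Lemma bounded_measurable_id {R : realType} (p q : R) :
  bounded_measurable p q id.
Proof.
split; first exact: measurable_id.
exists (`|p| + `|q|) => t /andP[pt tq]; rewrite ler_norml.
have := ler_norm q; have := ler_norm (- p); rewrite normrN.
have := normr_ge0 p; have := normr_ge0 q.
by move=> ? ? ? ?; apply/andP; split; lra.
Qed.

Lemma bounded_measurable_pospart {R : realType} (p q : R) (f : R -> R) :
  bounded_measurable p q f -> bounded_measurable p q (fun t => Num.max 0 (f t)).
Proof.
move=> [mf [M fM]]; split; first exact: measurable_maxr.
exists M => t /fM; apply: le_trans.
by rewrite ger0_norm ?le_max ?lexx// ge_max normr_ge0 ler_norm.
Qed.

Lemma bounded_measurable_indic {R : realType} (p q : R) (A : set R) :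
  measurable A -> bounded_measurable p q (\1_A).
Proof.
move=> mA; split; first exact: measurable_indic.
by exists 1 => t _; rewrite indicE; case: (_ \in _); rewrite ?normr1 ?normr0.
Qed.

(** * Integrals of piecewise affine functions *)

Lemma Rintegral_affine {R : realType} (p q c : R) : p <= q ->
  \int[mu]_(t in `[p, q]) (t - c) = ((q - c) ^+ 2 - (p - c) ^+ 2) / 2.
Proof.
rewrite le_eqVlt => /predU1P[->|pq].
  by rewrite set_itv1 Rintegral_set1; ring.
pose F : R^o -> R^o := 2^-1 \*: ((id : R^o -> R^o) - cst c) ^+ 2.
have FE t : F t = (t - c) ^+ 2 / 2 by rewrite mulrC.
have dF (t : R^o) : is_derive t (1 : R^o) F (t - c).
  have D1 : is_derive t (1 : R^o) ((id : R^o -> R^o) - cst c) (1 - 0).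
    by apply: is_deriveB.
  have D2 := is_deriveZ 2^-1 (is_deriveX 2 D1).
  apply: (is_derive_eq D2).
  by rewrite !fctE /GRing.scale /= subr0; field.
have cF : continuous F.
  by move=> t; apply: differentiable_continuous; apply/derivable1_diffP; apply: ex_derive.
rewrite /Rintegral (@continuous_FTC2 _ _ F)//=.
- by rewrite !FE; ring.
- apply: continuous_subspaceT => t.
  by apply: cvgB; [exact: cvg_id|exact: cvg_cst].
- split.
  + by move=> t _; apply: ex_derive.
  + by apply: cvg_at_right_filter; exact: cF.
  + by apply: cvg_at_left_filter; exact: cF.
- by move=> t _; rewrite derive1E; exact: derive_val.
Qed.

(** The ceiling obtained by joining the early bound before [b], participation between [b] and [a],
    and the late bound after [a]. It may be negative far from [[b, a]]. *)
Definition toll_cap {R : realType} (e L D b a t : R) : R :=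
  D - e * Num.max 0 (b - t) - L * Num.max 0 (t - a).

Lemma bounded_measurable_subl {R : realType} (p q c : R) :
  bounded_measurable p q (fun t => t - c).
Proof.
by apply: bounded_measurableB;
  [exact: bounded_measurable_id|exact: bounded_measurable_cst].
Qed.

Lemma bounded_measurable_subr {R : realType} (p q c : R) :
  bounded_measurable p q (fun t => c - t).
Proof.
by apply: bounded_measurableB;
  [exact: bounded_measurable_cst|exact: bounded_measurable_id].
Qed.

Lemma bounded_measurable_toll_cap {R : realType} (e L D b a p q : R) :
  bounded_measurable p q (toll_cap e L D b a).
Proof.
apply: bounded_measurableB; first apply: bounded_measurableB.
- exact: bounded_measurable_cst.
- apply: bounded_measurableM; first exact: bounded_measurable_cst.
  exact/bounded_measurable_pospart/bounded_measurable_subr.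
- apply: bounded_measurableM; first exact: bounded_measurable_cst.
  exact/bounded_measurable_pospart/bounded_measurable_subl.
Qed.

Lemma Rintegral_pospart {R : realType} (p q c : R) : p <= c -> c <= q ->
  \int[mu]_(t in `[p, q]) Num.max 0 (t - c) = (q - c) ^+ 2 / 2 /\
  \int[mu]_(t in `[p, q]) Num.max 0 (c - t) = (c - p) ^+ 2 / 2.
Proof.
move=> pc cq.
have i1 := bounded_measurable_integrable
  (bounded_measurable_pospart (bounded_measurable_subl p q c)).
have i2 := bounded_measurable_integrable
  (bounded_measurable_pospart (bounded_measurable_subr p q c)).
have := @Rintegral_itvB _ _ _ _ c i1.
have := @Rintegral_itvB _ _ _ _ c i2.
rewrite !bnd_simp => /(_ pc cq) H2 /(_ pc cq) H1.
have z (f : R -> R) (A : set R) : (forall t, A t -> f t = 0) ->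
    \int[mu]_(t in A) f t = 0.
  move=> f0; rewrite (@eq_Rintegral _ _ _ _ _ (cst 0)) => [|t /set_mem/f0//].
  by rewrite /Rintegral integral0.
have ia x y : mu.-integrable `[x, y] (EFin \o (fun t => t - c)).
  exact/bounded_measurable_integrable/bounded_measurable_subl.
split.
  move: H1; rewrite (z _ `[p, c]%classic); last first.
    by move=> t /=; rewrite in_itv/= => /andP[_ tc]; apply/max_idPl; lra.
  rewrite subr0 => ->; rewrite Rintegral_itv_obnd_cbnd; last first.
    apply: integrableS i1 => //; apply: subset_itvr; rewrite bnd_simp; exact: pc.
  transitivity (\int[mu]_(t in `[c, q]) (t - c)).
    by apply: eq_Rintegral => t /set_mem/=; rewrite in_itv/= => /andP[ct _]; apply/max_idPr; lra.
  by rewrite Rintegral_affine//; ring.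
move: H2; rewrite [X in _ = X](z _ `]c, q]%classic); last first.
  by move=> t /=; rewrite in_itv/= => /andP[ct _]; apply/max_idPl; lra.
move=> /subr0_eq ->.
transitivity (\int[mu]_(t in `[p, c]) (-1 * (t - c))).
  apply: eq_Rintegral => t /set_mem/=; rewrite in_itv/= => /andP[_ tc].
  by rewrite (_ : Num.max 0 (c - t) = c - t); [ring|apply/max_idPr; lra].
by rewrite RintegralZl// Rintegral_affine//; field.
Qed.

Lemma fine_lebesgue_measure_itv {R : realType} (c d : bool) (p q : R) : p <= q ->
  fine (mu [set` Interval (BSide c p) (BSide d q)]) = q - p.
Proof.
move=> pq; rewrite lebesgue_measure_itv/= lte_fin; case: ltP => [//|qp].
by rewrite (_ : p = q) ?subrr//; apply/le_anti; rewrite pq qp.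
Qed.

Lemma Rintegral_toll_cap {R : realType} (e L D b a u v : R) :
  b <= a -> 0 <= u -> 0 <= v ->
  \int[mu]_(t in `[b - u, a + v]) toll_cap e L D b a t =
  D * (u + v + a - b) - (e * u ^+ 2 + L * v ^+ 2) / 2.
Proof.
move=> ba u0 v0.
have B1 := bounded_measurable_pospart (bounded_measurable_subr (b - u) (a + v) b).
have B2 := bounded_measurable_pospart (bounded_measurable_subl (b - u) (a + v) a).
have Bc c := bounded_measurable_cst (b - u) (a + v) c.
have i1 := bounded_measurable_integrable B1.
have i2 := bounded_measurable_integrable B2.
have iD := bounded_measurable_integrable (Bc D).
have ie := bounded_measurable_integrable (bounded_measurableM (Bc e) B1).
have iL := bounded_measurable_integrable (bounded_measurableM (Bc L) B2).
have iDe := bounded_measurable_integrable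
  (bounded_measurableB (Bc D) (bounded_measurableM (Bc e) B1)).
rewrite /toll_cap RintegralB//.
rewrite RintegralB// !RintegralZl// Rintegral_cst//.
have [| |-> _] := @Rintegral_pospart _ (b - u) (a + v) a; [lra..|].
have [| |_ ->] := @Rintegral_pospart _ (b - u) (a + v) b; [lra..|].
rewrite [X in D * X](_ : _ = a + v - (b - u)); first by field.
by apply: fine_lebesgue_measure_itv; lra.
Qed.

Lemma indic_itv {R : realType} (i : interval R) (t : R) :
  \1_([set` i] : set R) t = (t \in i)%:R :> R.
Proof. by rewrite indicE mem_setE. Qed.

Lemma Rintegral_indic_itv {R : realType} (c d : bool) (lo hi p q : R) :
  lo <= p -> p <= q -> q <= hi ->
  \int[mu]_(t in `[lo, hi])
    \1_([set` Interval (BSide c p) (BSide d q)] : set R) t = q - p.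
Proof.
move=> lop pq qhi; rewrite /Rintegral integral_indic// setIidl.
  exact: fine_lebesgue_measure_itv.
by apply: subset_itv; rewrite bnd_simp.
Qed.

Lemma ae_imply2 {R : realType} (P Q S : R -> Prop) :
  (forall t, P t -> Q t -> S t) ->
  {ae mu, forall t, P t} -> {ae mu, forall t, Q t} -> {ae mu, forall t, S t}.
Proof. by move=> PQS; apply: (@filterS2 _ _ (ae_filter_ringOfSetsType _)). Qed.

Lemma ae_neq {R : realType} (c : R) : {ae mu, forall t : R, t != c}.
Proof.
exists [set c]; split => //; first exact: lebesgue_measure_set1.
by move=> t /=; move/negP; rewrite negbK => /eqP.
Qed.

(** A Lagrangian argument: the masses before [b] and after [a] are fixed, so each side gets a
    multiplier. The reduced price [psi] is then nonnegative on the window and nonpositive off it,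
    and filling the window at rate [m] is best. *)
Lemma bathtub {R : realType} (e L D b a u v m lo hi : R) (x : R -> R) :
  0 < e -> 0 < L -> 0 <= D -> b <= a -> 0 <= u -> 0 <= v -> 0 < m ->
  lo <= b - u -> a + v <= hi ->
  measurable_fun [set: R] x -> (forall t, 0 <= x t <= m) ->
  \int[mu]_(t in `[lo, hi]) (x t * \1_`]-oo, b[ t) = m * u ->
  \int[mu]_(t in `[lo, hi]) (x t * \1_`]a, +oo[ t) = m * v ->
  let V := m * (D * (u + v + a - b) - (e * u ^+ 2 + L * v ^+ 2) / 2) in
  [/\ \int[mu]_(t in `[lo, hi]) (x t * toll_cap e L D b a t) <= V,
      \int[mu]_(t in `[lo, hi])
        (m * \1_`[b - u, a + v] t * toll_cap e L D b a t) = V &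
      0 < D -> \int[mu]_(t in `[lo, hi]) (x t * toll_cap e L D b a t) = V ->
      {ae mu, forall t, lo <= t <= hi -> x t = m * \1_`[b - u, a + v] t}].
Proof.
move=> e0 L0 D0 ba u0 v0 m0 lob hia mx xm xb xa V.
pose y t := m * \1_(`[b - u, a + v] : set R) t.
pose th := toll_cap e L D b a.
pose ib : R -> R := \1_`]-oo, b[; pose ia : R -> R := \1_`]a, +oo[.
(* The multipliers are the cap's values at the two ends of the window, so that [psi] changes sign
   exactly there. *)
pose psi t := th t - (D - e * u) * ib t - (D - L * v) * ia t.
have Bc c := bounded_measurable_cst lo hi c.
have Bx : bounded_measurable lo hi x.
  by split => //; exists m => t _; case/andP: (xm t) => ? ?; rewrite ger0_norm.
have By : bounded_measurable lo hi y.
  by apply: bounded_measurableM (Bc m) _; exact: bounded_measurable_indic.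
have Bth : bounded_measurable lo hi th by exact: bounded_measurable_toll_cap.
have Bib : bounded_measurable lo hi ib by exact: bounded_measurable_indic.
have Bia : bounded_measurable lo hi ia by exact: bounded_measurable_indic.
have Bz := bounded_measurableB By Bx.
have Bzb := bounded_measurableM Bz Bib.
have Bza := bounded_measurableM Bz Bia.
have Bzt := bounded_measurableM Bz Bth.
have I f (Bf : bounded_measurable lo hi f) := bounded_measurable_integrable Bf.
have M := @bounded_measurableM R lo hi.
have cases t : [\/ [/\ t < b, psi t = e * (t - (b - u)) & y t = m * (b - u <= t)%R%:R],
    [/\ b <= t <= a, psi t = D & y t = m] |
    [/\ a < t, psi t = L * (a + v - t) & y t = m * (t <= a + v)%R%:R]].
  rewrite /psi /y /ib /ia /th /toll_cap !indic_itv !in_itv/= !andbT.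
  have [tb|bt] := ltP t b.
    apply: Or31; split => //.
      rewrite (_ : (a < t) = false); last by apply/negbTE; lra.
      rewrite (_ : Num.max 0 (b - t) = b - t); last by apply/max_idPr; lra.
      rewrite (_ : Num.max 0 (t - a) = 0); last by apply/max_idPl; lra.
      by rewrite mulr1 !mulr0; ring.
    by rewrite (_ : (t <= a + v)); [rewrite andbT|lra].
  have [ta|at_] := leP t a.
    apply: Or32; split => //.
      rewrite (_ : Num.max 0 (b - t) = 0); last by apply/max_idPl; lra.
      rewrite (_ : Num.max 0 (t - a) = 0); last by apply/max_idPl; lra.
      by rewrite !mulr0; ring.
    by rewrite (_ : (b - u <= t <= a + v)); [rewrite mulr1|lra].
  apply: Or33; split => //.
    rewrite (_ : Num.max 0 (b - t) = 0); last by apply/max_idPl; lra.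
    rewrite (_ : Num.max 0 (t - a) = t - a); last by apply/max_idPr; lra.
    by rewrite mulr1 !mulr0; ring.
  by rewrite (_ : (b - u <= t)); [|lra].
have yb : \int[mu]_(t in `[lo, hi]) (y t * ib t) = m * u.
  transitivity (\int[mu]_(t in `[lo, hi]) (m * \1_(`[b - u, b[ : set R) t)).
    apply: eq_Rintegral => t _.
    rewrite /y /ib !indic_itv !in_itv/= -mulrA -natrM mulnb; congr (m * (nat_of_bool _)%:R).
    by apply/idP/idP => /andP[? ?]; lra.
  rewrite RintegralZl//; last exact/I/bounded_measurable_indic.
  by rewrite Rintegral_indic_itv; [ring|lra..].
have ya : \int[mu]_(t in `[lo, hi]) (y t * ia t) = m * v.
  transitivity (\int[mu]_(t in `[lo, hi]) (m * \1_(`]a, a + v] : set R) t)).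
    apply: eq_Rintegral => t _.
    rewrite /y /ia !indic_itv !in_itv/= andbT -mulrA -natrM mulnb; congr (m * (nat_of_bool _)%:R).
    by apply/idP/idP => /andP[? ?]; lra.
  rewrite RintegralZl//; last exact/I/bounded_measurable_indic.
  by rewrite Rintegral_indic_itv; [ring|lra..].
have yV : \int[mu]_(t in `[lo, hi]) (y t * th t) = V.
  transitivity (\int[mu]_(t in `[lo, hi])
      (m * (th t * \1_(`[b - u, a + v] : set R) t))).
    by apply: eq_Rintegral => t _; rewrite /y; ring.
  rewrite RintegralZl//; last exact/I/M/bounded_measurable_indic.
  rewrite /V -Rintegral_toll_cap//; congr (m * _).
  transitivity (\int[mu]_(t in `[lo, hi]) ((th \_ (`[b - u, a + v] : set R)) t)).
    apply: eq_Rintegral => t _; rewrite indicE patchE.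
    by case: ifP => _; rewrite ?mulr1 ?mulr0.
  rewrite -Rintegral_mkcondr setIidr// => t /=; rewrite !in_itv/=.
  by move=> /andP[? ?]; lra.
(* [y] and [x] have equal mass before [b] and equal mass after [a], so the multiplier terms
   cancel. *)
have psiE : \int[mu]_(t in `[lo, hi]) ((y t - x t) * psi t) =
    V - \int[mu]_(t in `[lo, hi]) (x t * th t).
  transitivity (\int[mu]_(t in `[lo, hi])
    ((y t - x t) * th t - (D - e * u) * ((y t - x t) * ib t)
      - (D - L * v) * ((y t - x t) * ia t))).
    by apply: eq_Rintegral => t _; rewrite /psi; ring.
  have E (f : R -> R) : bounded_measurable lo hi f ->
    \int[mu]_(t in `[lo, hi]) ((y t - x t) * f t) =
    \int[mu]_(t in `[lo, hi]) (y t * f t) - \int[mu]_(t in `[lo, hi]) (x t * f t).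
    move=> Bf; rewrite -RintegralB; [|by []|exact/I/M|exact/I/M].
    by apply: eq_Rintegral => t _; ring.
  have Bzb' := M _ _ (Bc (D - e * u)) Bzb.
  have Bza' := M _ _ (Bc (D - L * v)) Bza.
  rewrite RintegralB; [|by []|exact/I/bounded_measurableB|exact/I].
  rewrite RintegralB; [|by []|exact/I|exact/I].
  rewrite !RintegralZl; [|by []|exact: I|by []|exact: I].
  by rewrite !E// yb ya yV xb xa; ring.
(* Where [psi] is nonnegative [y] equals [m >= x]; where it is negative [y] equals [0 <= x]. *)
have psi_ge0 t : 0 <= (y t - x t) * psi t.
  have /andP[x0 x1] := xm t.
  have sgn (k r : R) : 0 < k -> 0 <= (m * (0 <= r)%R%:R - x t) * (k * r).
    move=> k0; case: (lerP 0 r) => r0; rewrite ?mulr1 ?mulr0.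
      by apply: mulr_ge0; [lra|apply: mulr_ge0; lra].
    by apply: mulr_le0; [lra|rewrite pmulr_rle0 // ltW].
  case: (cases t) => -[_ -> ->].
  - by rewrite -(subr_ge0 (b - u)); exact: sgn.
  - by rewrite mulr_ge0// subr_ge0.
  - by rewrite -(subr_ge0 t); exact: sgn.
(* [psi] vanishes only at the ends of the window; between [b] and [a] it equals [D], whence the
   condition [0 < D]. *)
have psi_eq0 t : 0 < D -> t != b - u -> t != a + v ->
    (y t - x t) * psi t = 0 -> x t = y t.
  move=> Dgt tb ta /eqP; rewrite mulf_eq0 subr_eq0 => /orP[/eqP->//|/eqP].
  case: (cases t) => -[_ -> _] /eqP.
  - by rewrite mulf_eq0 (gt_eqF e0) subr_eq0 (negbTE tb).
  - by rewrite (gt_eqF Dgt).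
  - by rewrite mulf_eq0 (gt_eqF L0) subr_eq0 eq_sym (negbTE ta).
have Bpsi : bounded_measurable lo hi psi.
  apply: bounded_measurableB; last exact: M _ _ (Bc _) Bia.
  by apply: bounded_measurableB => //; exact: M _ _ (Bc _) Bib.
split=> //.
- rewrite -subr_ge0 -psiE; exact: Rintegral_ge0.
- move=> Dgt xV.
  have Bg := M _ _ Bz Bpsi.
  have mg : measurable_fun (`[lo, hi] : set R) (EFin \o (fun t => (y t - x t) * psi t)).
    exact: measurable_int (I _ Bg).
  have : (\int[mu]_(t in `[lo, hi]) `|((y t - x t) * psi t)%:E| = 0)%E.
    under eq_integral do rewrite gee0_abs ?lee_fin//.
    move: psiE; rewrite xV subrr /Rintegral => h0.
    rewrite -[LHS]fineK ?h0//; exact: integrable_fin_num (I _ Bg).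
  move=> /(ae_eq_integral_abs mu (measurable_itv _) mg).
  have h2 : {ae mu, forall t, t != b - u /\ t != a + v}.
    by apply: ae_imply2 (ae_neq (b - u)) (ae_neq (a + v)).
  move=> [N [mN N0 subN]].
  have h1 : {ae mu, forall t, lo <= t <= hi -> (y t - x t) * psi t = 0}.
    exists N; split => // t h; apply: subN => /= h'; apply: h => tJ.
    by have [] := h' tJ.
  apply: ae_imply2 h2 h1 => t [tb ta] h1 tJ.
  by apply: psi_eq0 => //; exact: h1.
Qed.

(** * Upper bound on equilibrium revenue *)

(** The linear branch climbs to [mu_f] at [n_c], and the congested branch starts from this positive
    value and drops strictly at once. Uniqueness of the maximizer later turns full outflow into
    critical accumulation. *)
Lemma mfd_le {R : realType} (m : urban_model R) (n : R) :
  standing_assumptions m -> congested_beyond_critical m ->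
  free_flow_below_critical m -> 0 <= n ->
  mfd m n <= mu_f m /\ (mfd m n = mu_f m -> n = n_c m).
Proof.
move=> hm cong free n0; have nc := n_c_gt0 hm; have mf := mu_f_gt0 hm.
have fnc : mfd m (n_c m) = mu_f m.
  by rewrite free ?divff ?mulr1 ?gt_eqF// lexx ltW.
have [nle|nlt] := leP n (n_c m).
  rewrite free ?n0//; split.
    by rewrite ger_pMr// ler_pdivrMr// mul1r.
  move=> E; suff : n / n_c m = 1 by move=> /divr1_eq.
  by apply: (mulfI (lt0r_neq0 mf)); rewrite E mulr1.
have [+ _] := cong _ _ (lexx _) nlt; rewrite fnc => /(_ mf) h.
by split; [exact: ltW|move=> E; move: h; rewrite E ltxx].
Qed.

Lemma delay_ge0 {R : realType} (m : urban_model R) (n : R) :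
  standing_assumptions m -> congested_beyond_critical m ->
  free_flow_below_critical m -> 0 <= n -> (0 <= delay m n)%E.
Proof.
move=> hm cong free n0; have nc := n_c_gt0 hm; have mf := mu_f_gt0 hm.
rewrite /delay; case: eqP => // /eqP nn0; case: eqP => // /eqP mn0.
have npos : 0 < n by rewrite lt_neqAle eq_sym nn0.
have mpos : 0 < mfd m n by rewrite lt_neqAle eq_sym mn0 mfd_ge0.
rewrite lee_fin subr_ge0.
have [nle|nlt] := leP n (n_c m).
  rewrite free ?n0// le_eqVlt; apply/orP; left; apply/eqP; field.
  by rewrite !gt_eqF.
rewrite ler_pdivrMr// mulrAC ler_pdivlMr//.
have [h _] := mfd_le hm cong free n0.
by rewrite ler_pM// ltW.
Qed.

(** * Drivers: cost inequalities and exit masses *)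

Definition drivers {R : realType} (m : urban_model R) (o : outcome R) : set R :=
  [set s | t1 m <= s <= t2 m /\ 0 < car_share o s].

(** Passage from extended to real costs: a driver pays at most [z_T], so the delay at his exit is
    finite. In gridlock [w] takes the default value 0, but no driver exits then. *)
Lemma driver_cost_ineqs {R : realType} (m : urban_model R) (tau : R -> R)
    (o : outcome R) :
  standing_assumptions m -> congested_beyond_critical m ->
  free_flow_below_critical m -> equilibrium m tau o ->
  exists w : R -> R, [/\ forall t, 0 <= w t,
    forall s s', drivers m o s -> drivers m o s' ->
      w (exit_time o s) + tau (exit_time o s)
        + sched (earliness m) (lateness m) (exit_time o s) s <=
      w (exit_time o s') + tau (exit_time o s')
        + sched (earliness m) (lateness m) (exit_time o s') s &
    forall s, drivers m o s ->
      w (exit_time o s) + tau (exit_time o s)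
        + sched (earliness m) (lateness m) (exit_time o s) s <= z_T m - z_C m].
Proof.
move=> hm cong free [fea eqt eqc _].
pose w t := fine (delay m (accumulation o t)).
have d0 t : (0 <= delay m (accumulation o t))%E.
  exact: delay_ge0 hm cong free (fl_acc_ge0 fea t).
have costE t s : delay m (accumulation o t) != +oo%E ->
    cost m tau o t s = (z_C m + (w t + tau t
      + sched (earliness m) (lateness m) t s))%:E.
  move=> dfin; have dE : delay m (accumulation o t) = (w t)%:E.
    by rewrite /w fineK// ge0_fin_numE// ltey.
  rewrite /cost dE; apply: (congr1 EFin); rewrite /sched.
  by lra.
have dfin s : drivers m o s -> delay m (accumulation o (exit_time o s)) != +oo%E.
  move=> [st ps]; apply/eqP => dE; have := eqc _ st ps.
  by rewrite /cost dE /= !addye// leye_eq.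
exists w; split.
- by move=> t; exact: fine_ge0.
- move=> s s' Ss Ss'; have [st ps] := Ss.
  by have := eqt _ st ps (exit_time o s'); rewrite !costE ?dfin// lee_fin lerD2l.
- move=> s Ss; have [st ps] := Ss.
  by have := eqc _ st ps; rewrite costE ?dfin// lee_fin lerBrDl.
Qed.

Lemma desired_rate_gt0 {R : realType} (m : urban_model R) :
  standing_assumptions m -> 0 < desired_rate m.
Proof.
by move=> hm; rewrite divr_gt0 ?subr_gt0 ?(mass_gt0 hm) ?(t1_lt_t2 hm).
Qed.

Lemma exit_rate_bounds {R : realType} (m : urban_model R) (o : outcome R) t :
  standing_assumptions m -> congested_beyond_critical m ->
  free_flow_below_critical m -> feasible m o ->
  0 <= exit_rate m o t <= mu_f m.
Proof.
move=> hm cong free fea; have n0 := fl_acc_ge0 fea t.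
by rewrite /exit_rate mfd_ge0//; have [] := mfd_le hm cong free n0.
Qed.

Lemma exit_rate_outside {R : realType} (m : urban_model R) (o : outcome R) t :
  standing_assumptions m -> free_flow_below_critical m -> feasible m o ->
  ~ (t_A o <= t <= t_D o) -> exit_rate m o t = 0.
Proof.
move=> hm free fea /(fl_outside fea); rewrite /exit_rate => ->.
by rewrite free ?mul0r ?mulr0// lexx ltW ?(n_c_gt0 hm).
Qed.

Lemma measurable_drivers {R : realType} (m : urban_model R) (o : outcome R) :
  feasible m o -> measurable (drivers m o) /\
    measurable_fun (drivers m o) (exit_time o) /\
    measurable_fun (drivers m o) (car_share o).
Proof.
move=> fea; have ms := fl_measurable_share fea.
have mS : measurable (drivers m o).
  have -> : drivers m o = `[t1 m, t2 m] `&` car_share o @^-1` `]0, +oo[.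
    by apply/seteqP; split => s /=; rewrite !in_itv/= andbT.
  exact: ms.
split => //; split.
  apply: monotone_measurable => // s s' [st ps] [st' ps'].
  exact: (fl_order fea).
by apply: measurable_funS ms => // s [st _] /=; rewrite in_itv.
Qed.

Lemma integral_drivers_le {R : realType} (m : urban_model R) (o : outcome R)
    (A : set R) (p q : R) :
  standing_assumptions m -> feasible m o ->
  measurable A -> A `<=` drivers m o -> A `<=` `[p, q] -> p <= q ->
  (\int[mu]_(s in A) (desired_rate m * car_share o s)%:E <=
   (desired_rate m * (q - p))%:E)%E.
Proof.
move=> hm fea mA AS Apq pq; have l0 := desired_rate_gt0 hm.
have [mS [_ mp]] := measurable_drivers fea.
have mAp : measurable_fun A (fun s => desired_rate m * car_share o s).
  apply: measurable_funM; first exact: measurable_cst.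
  exact: measurable_funS AS mp.
apply: (@le_trans _ _ (\int[mu]_(s in A) (desired_rate m)%:E)%E).
  apply: ge0_le_integral => //.
  - by move=> s /AS[st ps]; rewrite lee_fin mulr_ge0 ?ltW.
  - exact/measurable_EFinP.
  - by move=> s /AS[st _]; rewrite lee_fin ger_pMr//; case/andP: (fl_share fea st).
rewrite integral_cst// (EFinM _ (q - p)) lee_pmul2l//.
apply: (@le_trans _ _ (mu (`[p, q] : set R))); first by apply: le_measure; rewrite ?inE.
by rewrite lebesgue_measure_itv/= lte_fin; case: ltP; rewrite ?lee_fin ?subr_ge0// EFinB.
Qed.

Lemma exit_time_image {R : realType} (m : urban_model R) (o : outcome R)
    (A : set R) :
  standing_assumptions m -> congested_beyond_critical m ->
  free_flow_below_critical m -> feasible m o -> measurable A ->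
  (\int[mu]_(s in drivers m o `&` exit_time o @^-1` A)
     (desired_rate m * car_share o s)%:E
   = \int[mu]_(x in A) (exit_rate m o x)%:E)%E.
Proof.
move=> hm cong free fea mA; have [mS [mT mp]] := measurable_drivers fea.
have l0 := desired_rate_gt0 hm.
apply: (@monotone_image_density _ _ (fun s => desired_rate m * car_share o s)) => //.
- by apply: measurable_funM => //; exact: measurable_cst.
- by move=> s [_ ps]; rewrite mulr_ge0// ltW.
- exact: fl_measurable_rate.
- by move=> t; case/andP: (exit_rate_bounds t hm cong free fea).
- by move=> s s' [st ps] [st' ps']; exact: (fl_order fea).
- move=> t; rewrite -(fl_conservation fea); congr integral.
  by apply/seteqP; split => s /=; [case=> -[]|case].
- apply: le_lt_trans (ltry (desired_rate m * (t2 m - t1 m))).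
  apply: integral_drivers_le => //; last exact: ltW (t1_lt_t2 hm).
  by move=> s [st _] /=; rewrite in_itv.
Qed.

(** Cumulative exits [F] grow at rate at most [mu_f], strictly slower than desired exits. Each
    crossing with a line of slope [l] therefore leaves an excess of exits before [b], and of exits
    still to come after [a], which only drivers off schedule can supply. *)
Lemma exit_profile {R : realType} (m : urban_model R) (o : outcome R) (lo hi : R) :
  standing_assumptions m -> congested_beyond_critical m ->
  free_flow_below_critical m -> mu_f m < desired_rate m -> feasible m o ->
  lo <= t_A o -> t_D o <= hi -> lo <= t1 m -> t2 m <= hi ->
  exists b a, [/\ [/\ t1 m <= b, b <= a & a <= t2 m],
    \int[mu]_(t in `[lo, hi]) (exit_rate m o t * \1_`]-oo, b[ t) =
      desired_rate m * (b - t1 m),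
    \int[mu]_(t in `[lo, hi]) (exit_rate m o t * \1_`]a, +oo[ t) =
      desired_rate m * (t2 m - a),
    forall t, t1 m <= t < b ->
      exists s, [/\ drivers m o s, t < s & exit_time o s <= t] &
    forall t, a < t <= t2 m ->
      exists s, [/\ drivers m o s, s < t & t <= exit_time o s]].
Proof.
move=> hm cong free cap fea lotA tDhi lot1 t2hi.
have T12 := t1_lt_t2 hm; have l0 := desired_rate_gt0 hm.
have mf0 := mu_f_gt0 hm.
set l := desired_rate m in cap l0 *; pose x := exit_rate m o.
have xb t := exit_rate_bounds t hm cong free fea.
have mx : measurable_fun [set: R] x := fl_measurable_rate fea.
have Bx p q : bounded_measurable p q x.
  by split => //; exists (mu_f m) => t _; case/andP: (xb t) => ? ?; rewrite ger0_norm.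
have Ix p q := bounded_measurable_integrable (Bx p q).
have [mS [mT _]] := measurable_drivers fea.
pose F t := \int[mu]_(y in `[lo, t]) x y.
have FE t : (\int[mu]_(y in `[lo, t]) (x y)%:E = (F t)%:E)%E.
  by rewrite /F /Rintegral fineK//; exact: integrable_fin_num (Ix lo t).
have Fsub t t' : lo <= t -> t <= t' ->
    (\int[mu]_(y in `]t, t']) (x y)%:E = (F t' - F t)%:E)%E.
  move=> lot tt'; rewrite /F Rintegral_itvB ?bnd_simp//.
  rewrite /Rintegral fineK//; apply: integrable_fin_num => //.
  by apply: integrableS (Ix lo t') => //; apply: subset_itvr; rewrite bnd_simp.
have Fge t t' : lo <= t -> t <= t' -> F t <= F t'.
  move=> h1 h2; rewrite -subr_ge0 -lee_fin -Fsub//; apply: integral_ge0 => y _.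
  by rewrite lee_fin; case/andP: (xb y).
have Fle t t' : lo <= t -> t <= t' -> F t' - F t <= mu_f m * (t' - t).
  move=> h1 h2; rewrite -lee_fin -Fsub//.
  apply: (@le_trans _ _ (\int[mu]_(y in `]t, t']) (mu_f m)%:E)%E).
    apply: ge0_le_integral => //.
    - by move=> y _; rewrite lee_fin; case/andP: (xb y).
    - by apply/measurable_EFinP; exact: measurable_funTS.
    - by move=> y _; rewrite lee_fin; case/andP: (xb y).
  rewrite integral_cst// EFinM lee_pmul2l//.
  have h : (mu (`]t, t'] : set R) <= (t' - t)%:E)%E.
    by rewrite lebesgue_measure_itv/= lte_fin; case: ltP; rewrite ?lee_fin ?subr_ge0// EFinB.
  exact: h.
have F0 : F lo = 0 by rewrite /F set_itv1 Rintegral_set1.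
have Fray t : lo <= t -> (\int[mu]_(y in `]-oo, t]) (x y)%:E = (F t)%:E)%E.
  move=> lot; rewrite -FE.
  have -> : `[lo, t]%classic = `]-oo, t] `&` `[lo, +oo[ :> set R.
    by apply/seteqP; split => y /=; rewrite !in_itv/= => h; lra.
  rewrite integral_mkcondr; apply: eq_integral => y _; rewrite patchE.
  case: ifPn => // /negP yJ; congr EFin.
  apply: exit_rate_outside => // /andP[h _]; apply: yJ; rewrite mem_set//=.
  by rewrite in_itv/= (le_trans lotA h).
have image_x (A : set R) : measurable A ->
    (\int[mu]_(s in drivers m o `&` exit_time o @^-1` A)
       (l * car_share o s)%:E = \int[mu]_(y in A) (x y)%:E)%E.
  exact: exit_time_image.
have Fmass t p q : lo <= t -> drivers m o `&` exit_time o @^-1` `]-oo, t] `<=` `[p, q] ->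
    p <= q -> F t <= l * (q - p).
  move=> lot h pq.
  have E := etrans (image_x _ (measurable_itv `]-oo, t])) (Fray t lot).
  rewrite -lee_fin -E.
  apply: (integral_drivers_le hm fea _ _ h pq); last exact: subIsetl.
  exact: mT.
have N_le : F hi <= l * (t2 m - t1 m).
  apply: Fmass; [by rewrite (le_trans lot1)// (le_trans (ltW T12))| |exact: ltW].
  by move=> s [[st _] _] /=; rewrite in_itv.
have Fc : {within `[t1 m, t2 m], continuous F}.
  apply: (@continuous_subspaceW _ _ _ `[lo, t2 m]).
    by apply: subset_itvr; rewrite bnd_simp.
  apply: parameterized_integral_continuous; last exact: Ix.
  by rewrite (le_trans lot1)// ltW.
have lin_c (c d : R) : {within `[t1 m, t2 m], continuous (fun t : R => c * t + d)}.
  apply: continuous_subspaceT => t; apply: cvgD; last exact: cvg_cst.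
  by apply: cvgM; [exact: cvg_cst|exact: cvg_id].
(* The difference from the line through [(t1, 0)] is [F (t1) >= 0] at the start and at most
   [F hi - l * (t2 - t1) <= 0] at the end. *)
have [b bt FB] : exists2 b, b \in `[t1 m, t2 m] & F b = l * (b - t1 m).
  have [|||b bI Gb] := @IVT R (fun t => F t - (l * t + - (l * t1 m))) (t1 m) (t2 m) 0.
  - exact: ltW.
  - by move=> t; apply: cvgB; [exact: Fc|exact: lin_c].
  - rewrite ge_min le_max; apply/andP; split; apply/orP; [right|left].
    + by have := Fge _ _ (le_trans lot1 (ltW T12)) t2hi; lra.
    + by have := Fge _ _ (lexx lo) lot1; rewrite F0; lra.
  exists b => //; move: Gb => /eqP; rewrite subr_eq0 => /eqP ->; ring.
have [a at_ FA] : exists2 a, a \in `[t1 m, t2 m] & F hi - F a = l * (t2 m - a).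
  have [|||a aI Ga] :=
    @IVT R (fun t => F t - (l * t + (F hi - l * t2 m))) (t1 m) (t2 m) 0.
  - exact: ltW.
  - by move=> t; apply: cvgB; [exact: Fc|exact: lin_c].
  - rewrite ge_min le_max; apply/andP; split; apply/orP; [right|left].
    + by have := Fge _ _ (le_trans lot1 (ltW T12)) t2hi; lra.
    + by have := Fge _ _ (lexx lo) lot1; rewrite F0; lra.
  exists a => //; move: Ga => /eqP; rewrite subr_eq0 => /eqP ->; ring.
move: bt at_; rewrite !in_itv/= => /andP[t1b bt2] /andP[t1a at2].
(* If [a < b], the two crossing equations and [N_le] make at least [l * (b - a)] exits occur in
   between, more than capacity allows. *)
have ba : b <= a.
  rewrite leNgt; apply/negP => ab.
  have := Fle a b (le_trans lot1 t1a) (ltW ab).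
  nra.
exists b, a; split.
- by split.
- have lob := le_trans lot1 t1b; have bhi := le_trans bt2 t2hi.
  transitivity (F b) => //.
  transitivity (\int[mu]_(t in `[lo, hi]) ((x \_ (`]-oo, b[ : set R)) t)).
    apply: eq_Rintegral => t _; rewrite indicE patchE.
    by case: ifP => _; rewrite ?mulr1 ?mulr0.
  rewrite -Rintegral_mkcondr.
  have -> : `[lo, hi]%classic `&` `]-oo, b[ = `[lo, b[%classic :> set R.
    by apply/seteqP; split => t /=; rewrite !in_itv/= => h; lra.
  rewrite Rintegral_itv_bndo_bndc//.
  by apply: integrableS (Ix lo b) => //; apply: subset_itvl; rewrite bnd_simp.
- have loa := le_trans lot1 t1a; have ahi := le_trans at2 t2hi.
  transitivity (F hi - F a) => //.
  transitivity (\int[mu]_(t in `[lo, hi]) ((x \_ (`]a, +oo[ : set R)) t)).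
    apply: eq_Rintegral => t _; rewrite indicE patchE.
    by case: ifP => _; rewrite ?mulr1 ?mulr0.
  rewrite -Rintegral_mkcondr.
  have -> : `[lo, hi]%classic `&` `]a, +oo[ = `]a, hi]%classic :> set R.
    by apply/seteqP; split => t /=; rewrite !in_itv/= => h; lra.
  by rewrite /Rintegral Fsub.
- move=> t /andP[t1t tb]; apply: contrapT => no.
  have := Fle t b (le_trans lot1 t1t) (ltW tb).
  (* If nobody has left ahead of schedule, all exits by [t] come from desired times in [[t1, t]];
     capacity then keeps [F] below the line up to [b]. *)
  have : F t <= l * (t - t1 m).
    apply: (Fmass _ _ _ (le_trans lot1 t1t)) => // s [[st ps] Tst] /=; rewrite in_itv/=.
    move/andP: (st) => [-> _] /=; rewrite leNgt; apply/negP => ts.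
    by apply: no; exists s; split => //; move: Tst; rewrite /= in_itv.
  nra.
- move=> t /andP[at' tt2]; apply: contrapT => no.
  have := Fle a t (le_trans lot1 t1a) (ltW at').
  have : F hi - F t <= l * (t2 m - t).
    have thi := le_trans tt2 t2hi.
    have lot : lo <= t by rewrite (le_trans lot1)// (le_trans t1a)// ltW.
    have E := etrans (image_x _ (measurable_itv `]t, hi])) (Fsub t hi lot thi).
    rewrite -lee_fin -E.
    have mA : measurable (drivers m o `&` exit_time o @^-1` `]t, hi]) by exact: mT.
    apply: (integral_drivers_le hm fea mA _ _ tt2); first exact: subIsetl.
    move=> s [[st ps] Tst] /=; rewrite in_itv/=.
    move/andP: (st) => [_ ->]; rewrite andbT leNgt; apply/negP => ts.
    by apply: no; exists s; split => //; move: Tst; rewrite /= in_itv/= => /andP[/ltW].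
  nra.
Qed.

Lemma ae_imply {R : realType} (P Q : R -> Prop) :
  (forall t, P t -> Q t) -> {ae mu, forall t, P t} -> {ae mu, forall t, Q t}.
Proof. by move=> PQ H; apply: (ae_imply2 _ H H) => t /PQ. Qed.

Lemma ae_itv_ex {R : realType} (P : R -> Prop) (p q : R) :
  {ae mu, forall t, P t} -> p < q -> exists2 t, p < t < q & P t.
Proof.
move=> [N [mN N0 subN]] pq; apply: contrapT => no.
have sub : `]p, q[ `<=` N.
  move=> t /=; rewrite in_itv/= => tpq; apply: subN => /= Pt.
  by apply: no; exists t.
have : (mu (`]p, q[ : set R) <= mu N)%E by apply: le_measure; rewrite ?inE.
by rewrite N0 lebesgue_measure_itv/= lte_fin pq -EFinB lee_fin subr_le0 leNgt pq.
Qed.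

Lemma integral_eq0_ae {R : realType} (A : set R) (f : R -> R) :
  measurable A -> measurable_fun [set: R] f -> (forall t, 0 <= f t) ->
  (\int[mu]_(t in A) (f t)%:E = 0)%E -> {ae mu, forall t, A t -> f t = 0}.
Proof.
move=> mA mf f0 f_eq0.
have mg : measurable_fun A (EFin \o f).
  by apply/measurable_EFinP; exact: measurable_funTS.
have : (\int[mu]_(t in A) `|(f t)%:E| = 0)%E.
  by under eq_integral do rewrite gee0_abs ?lee_fin//.
move=> /(ae_eq_integral_abs mu mA mg)[N [mN N0 subN]].
exists N; split => // t h; apply: subN => /= h'; apply: h => tA.
by have [] := h' tA.
Qed.

(** Exits fill the window and vanish off it almost everywhere; minimality of [[t_A, t_D]], through
    [fl_first] and [fl_last], then confines it to [[p, q]]. *)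
Lemma full_capacity_window {R : realType} (m : urban_model R) (o : outcome R)
    (lo hi p q : R) :
  standing_assumptions m -> free_flow_below_critical m -> feasible m o ->
  p < q -> lo <= p -> q <= hi -> lo <= t_A o -> t_D o <= hi ->
  {ae mu, forall t, lo <= t <= hi ->
     exit_rate m o t = mu_f m * \1_(`[p, q] : set R) t} ->
  t_A o < t_D o /\
  {ae mu, forall t, t_A o <= t <= t_D o -> exit_rate m o t = mu_f m}.
Proof.
move=> hm free fea W lop qhi loA hiD xW.
have mf0 := mu_f_gt0 hm; pose x := exit_rate m o.
have mx : measurable_fun [set: R] x := fl_measurable_rate fea.
have out t : x t != 0 -> t_A o <= t <= t_D o.
  move=> xt; apply: contrapT => h; move/eqP: xt; apply.
  exact: exit_rate_outside h.
have inW p' q' : p <= p' -> p' < q' -> q' <= q ->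
    exists2 t, p' < t < q' & t_A o <= t <= t_D o.
  move=> bp pq' qa; have [t /andP[pt tq] xt] := ae_itv_ex xW pq'.
  exists t; first by rewrite pt.
  apply: out; rewrite /x xt; last by apply/andP; split; lra.
  by rewrite indic_itv in_itv/= (_ : (_ <= _ <= _)) ?mulr1 ?gt_eqF//; lra.
have AD : t_A o < t_D o.
  pose c := (p + q) / 2.
  have [||| t /andP[_ tc] /andP[At _]] := inW p c; [rewrite /c; lra..|].
  have [||| t' /andP[ct _] /andP[_ tD]] := inW c q; [rewrite /c; lra..|].
  by rewrite (le_lt_trans At)// (lt_trans tc)// (lt_le_trans ct).
have int0 (p' q' : R) : lo <= p' -> q' <= hi ->
    (forall t, p' <= t <= q' -> t != p -> t != q -> ~~ (p <= t <= q)) ->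
    (\int[mu]_(t in `[p', q']) (x t)%:E = 0)%E.
  move=> lop' qhi' h; rewrite -(integral0 mu (`[p', q'] : set R)).
  apply: ae_eq_integral => //.
    by apply/measurable_EFinP; exact: measurable_funTS.
  have h2 : {ae mu, forall t, t != p /\ t != q}.
    by apply: ae_imply2 (ae_neq p) (ae_neq q).
  apply: ae_imply2 xW h2 => t xt [tb ta] /=; rewrite in_itv/= => /andP[pt tq].
  congr EFin; rewrite /= /x xt; last by apply/andP; split; lra.
  by rewrite indic_itv in_itv/= (negbTE (h _ _ _ _)) ?mulr0// pt.
have pA : p <= t_A o.
  rewrite leNgt; apply/negP => Ab.
  (* A point strictly inside []t_A, t_D[] and not beyond [p]: no exits occur up to [c], against
     [fl_first]. *)
  pose c := Num.min p ((t_A o + t_D o) / 2).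
  have cb : c <= p by rewrite ge_min lexx.
  have cD : c <= (t_A o + t_D o) / 2 by rewrite ge_min lexx orbT.
  have Ac : t_A o < c by rewrite lt_min Ab; lra.
  have := fl_first fea (t := c); rewrite Ac (_ : c < t_D o); last lra.
  move=> /(_ isT); rewrite int0 ?ltxx//; first lra.
  move=> t /andP[_ tc] tb _; apply/negP => /andP[bt _].
  by move/eqP: tb; apply; apply/le_anti; rewrite bt (le_trans tc).
have Dq : t_D o <= q.
  rewrite leNgt; apply/negP => aD.
  pose c := Num.max q ((t_A o + t_D o) / 2).
  have cb : q <= c by rewrite le_max lexx.
  have cD : (t_A o + t_D o) / 2 <= c by rewrite le_max lexx orbT.
  have Ac : c < t_D o by rewrite gt_max aD; lra.
  have := fl_last fea (t := c); rewrite Ac (_ : t_A o < c); last lra.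
  move=> /(_ isT); rewrite int0 ?ltxx//; first lra.
  move=> t /andP[ct _] _ ta; apply/negP => /andP[_ at_].
  by move/eqP: ta; apply; apply/le_anti; rewrite at_ (le_trans cb).
split => //.
apply: ae_imply xW => t xt /andP[At tD]; rewrite xt; last first.
  by apply/andP; split; lra.
by rewrite indic_itv in_itv/= (_ : (_ <= _ <= _)) ?mulr1//; lra.
Qed.

(* Revenue from exits at full capacity during a window starting [u] before the
   last early exit and ending [v] after the first late one; [r] is the ratio of
   capacity to desired rate and [T] the length of the desired interval. *)
Definition window_revenue {R : realType} (k r e L D T u v : R) : R :=
  k * (D * (u + v + (T - r * (u + v))) - (e * u ^+ 2 + L * v ^+ 2) / 2).

Lemma equilibrium_revenue_le {R : realType} (m : urban_model R) (tau : R -> R)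
    (o : outcome R) :
  standing_assumptions m -> congested_beyond_critical m ->
  free_flow_below_critical m -> mu_f m < desired_rate m -> z_C m <= z_T m ->
  toll tau -> equilibrium m tau o ->
  let r := mu_f m / desired_rate m in
  let T := t2 m - t1 m in
  exists u v, [/\ 0 <= u, 0 <= v, r * (u + v) <= T,
    (outcome_revenue m tau o <= (window_revenue (mu_f m) r
       (earliness m) (lateness m) (z_T m - z_C m) T u v)%:E)%E &
    z_C m < z_T m ->
    outcome_revenue m tau o = (window_revenue (mu_f m) r
       (earliness m) (lateness m) (z_T m - z_C m) T u v)%:E ->
    t_A o < t_D o /\
    {ae mu, forall t, t_A o <= t <= t_D o -> exit_rate m o t = mu_f m}].
Proof.
move=> hm cong free cap hz [mtau tau0] eqo r T.
have fea := eq_feasible eqo.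
have mf0 := mu_f_gt0 hm; have l0 := desired_rate_gt0 hm.
have e0 := earliness_gt0 hm; have L0 := lateness_gt0 hm.
have T12 := t1_lt_t2 hm.
set l := desired_rate m in cap l0 r *; set k := mu_f m in mf0 cap r *.
set e := earliness m in e0 *; set L := lateness m in L0 *.
set D := z_T m - z_C m.
have D0 : 0 <= D by rewrite subr_ge0.
have T0 : 0 < T by rewrite subr_gt0.
have r0 : 0 < r by rewrite divr_gt0.
have r1 : r < 1 by rewrite ltr_pdivrMr// mul1r.
have krl : k = r * l by rewrite divfK// gt_eqF.
(* Since [u] and [v] are at most [T / r], the frame [[lo, hi]] contains both all exits and the
   window [[b - u, a + v]]. *)
pose lo := Num.min (t_A o) (t1 m - T / r).
pose hi := Num.max (t_D o) (t2 m + T / r).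
have Tr0 : 0 < T / r by rewrite divr_gt0.
have loA : lo <= t_A o by rewrite ge_min lexx.
have lo1 : lo <= t1 m - T / r by rewrite ge_min lexx orbT.
have hiD : t_D o <= hi by rewrite le_max lexx.
have hi2 : t2 m + T / r <= hi by rewrite le_max lexx orbT.
have [||b [a [[t1b ba at2] xb xa progb proga]]] :=
  @exit_profile _ m o lo hi hm cong free cap fea loA hiD; try lra.
pose u := (b - t1 m) / r; pose v := (t2 m - a) / r.
have ru : r * u = b - t1 m by rewrite mulrC divfK// gt_eqF.
have rv : r * v = t2 m - a by rewrite mulrC divfK// gt_eqF.
have u0 : 0 <= u by rewrite divr_ge0 ?subr_ge0// ltW.
have v0 : 0 <= v by rewrite divr_ge0 ?subr_ge0// ltW.
pose x := exit_rate m o.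
have xbd t : 0 <= x t <= k := exit_rate_bounds t hm cong free fea.
have x0 t : 0 <= x t by case/andP: (xbd t).
have mx : measurable_fun [set: R] x := fl_measurable_rate fea.
have uT : u <= T / r by rewrite ler_pM2r ?invr_gt0//; rewrite /T; lra.
have vT : v <= T / r by rewrite ler_pM2r ?invr_gt0//; rewrite /T; lra.
have lobu : lo <= b - u by lra.
have avhi : a + v <= hi by lra.
pose th := toll_cap e L D b a.
have lk y : l * y = k * (y / r).
  by rewrite krl; field; rewrite gt_eqF.
rewrite (lk (b - t1 m)) in xb; rewrite (lk (t2 m - a)) in xa.
have [Vle _ Veq] := @bathtub _ e L D b a u v k lo hi x e0 L0 D0 ba u0 v0 mf0
  lobu avhi mx xbd xb xa.
have VE : k * (D * (u + v + a - b) - (e * u ^+ 2 + L * v ^+ 2) / 2) =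
    window_revenue k r e L D T u v.
  rewrite /window_revenue; congr (_ * (D * _ - _)).
  by rewrite (mulrDr r) ru rv /T; ring.
rewrite VE in Vle Veq.
have price s : drivers m o s -> tau (exit_time o s) <= th (exit_time o s).
  move=> Ss; have [w [w0 ic ir]] := driver_cost_ineqs hm cong free eqo.
  pose G t := w t + tau t.
  have bnd s' : drivers m o s' -> t1 m <= s' <= t2 m by case.
  have mono s1 s2 : drivers m o s1 -> drivers m o s2 -> s1 < s2 ->
      exit_time o s1 <= exit_time o s2.
    by move=> [? ?] [? ?]; exact: (fl_order fea).
  have early := @early_price_le R e L D (t1 m) (t2 m) b _ _ G e0 L0 bnd mono ic ir progb s Ss.
  have late := @late_price_le R e L D (t1 m) (t2 m) a _ _ G e0 L0 bnd mono ic ir proga s Ss.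
  have := ir s Ss; have := w0 (exit_time o s).
  move: early late; rewrite /G /th /toll_cap /sched -/e -/L.
  set t := exit_time o s.
  have p0 (y z : R) : 0 < y -> 0 <= y * Num.max 0 z.
    by move=> y0; rewrite mulr_ge0 ?le_max ?lexx// ltW.
  have := p0 e (s - t) e0; have := p0 L (t - s) L0.
  case: (ltP t b) => tb; case: (ltP a t) => ta.
  - by have := lt_le_trans tb (le_trans ba (ltW ta)); rewrite ltxx.
  - rewrite (_ : Num.max 0 (b - t) = b - t); last by apply/max_idPr; lra.
    rewrite (_ : Num.max 0 (t - a) = 0); last by apply/max_idPl; lra.
    by move=> _ _ /(_ isT) + _; lra.
  - rewrite (_ : Num.max 0 (b - t) = 0); last by apply/max_idPl; lra.
    rewrite (_ : Num.max 0 (t - a) = t - a); last by apply/max_idPr; lra.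
    by move=> _ _ _ /(_ isT); lra.
  - rewrite (_ : Num.max 0 (b - t) = 0); last by apply/max_idPl; lra.
    rewrite (_ : Num.max 0 (t - a) = 0); last by apply/max_idPl; lra.
    by rewrite -/D; lra.
pose Bad := [set t | th t < tau t].
have mth : measurable_fun [set: R] th by case: (bounded_measurable_toll_cap e L D b a lo hi).
(* No driver exits at a time in [Bad], so its preimage is empty and conservation makes the exit rate
   vanish almost everywhere on it. *)
have mBad : measurable Bad.
  rewrite (_ : Bad = setT `&` (fun t => tau t - th t) @^-1` `]0, +oo[).
    by apply: (measurable_funB mtau mth) => //.
  by apply/seteqP; split => t; rewrite /Bad/= in_itv/= andbT subr_gt0 //; case.
have xBad : {ae mu, forall t, Bad t -> x t = 0}.
  apply: integral_eq0_ae => //.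
  have <- := exit_time_image hm cong free fea mBad.
  rewrite (_ : _ `&` _ = set0) ?integral_set0//.
  by apply/seteqP; split => // s [/price + ]; rewrite /Bad/= ltNge => ->.
have revE : (outcome_revenue m tau o <=
    (\int[mu]_(t in `[lo, hi]) (x t * th t))%:E)%E.
  have mxt : measurable_fun [set: R] (fun t => x t * tau t) by exact: measurable_funM.
  have mxh : measurable_fun [set: R] (fun t => x t * th t) by exact: measurable_funM.
  have mxp : measurable_fun [set: R] (fun t => x t * Num.max 0 (th t)).
    by apply: measurable_funM => //; exact: measurable_maxr.
  have ImE : (\int[mu]_(t in `[lo, hi]) (x t * th t)%:E =
      (\int[mu]_(t in `[lo, hi]) (x t * th t))%:E)%E.
    rewrite /Rintegral fineK//; apply: integrable_fin_num => //.
    apply: bounded_measurable_integrable; apply: bounded_measurableM.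
      by split => //; exists k => t _; rewrite ger0_norm//; case/andP: (xbd t).
    exact: bounded_measurable_toll_cap.
  rewrite -ImE.
  apply: (@le_trans _ _ (\int[mu]_(t in `[lo, hi]) (x t * tau t)%:E)%E).
    apply: ge0_subset_integral => //.
    - by apply/measurable_EFinP; exact: measurable_funTS.
    - by move=> t _; rewrite lee_fin mulr_ge0.
    - by apply: subset_itv; rewrite bnd_simp.
  (* The positive part keeps integrands nonnegative for monotonicity. It costs nothing: off [Bad]
     the cap is at least [tau >= 0], and on [Bad] the rate is almost everywhere 0. *)
  apply: (@le_trans _ _ (\int[mu]_(t in `[lo, hi]) (x t * Num.max 0 (th t))%:E)%E).
    apply: ae_ge0_le_integral => //.
    - by move=> t _; rewrite lee_fin mulr_ge0.
    - by apply/measurable_EFinP; exact: measurable_funTS.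
    - by move=> t _; rewrite lee_fin mulr_ge0// le_max lexx.
    - by apply/measurable_EFinP; exact: measurable_funTS.
    apply: ae_imply xBad => t xt _; rewrite lee_fin.
    have [tb|bt] := ltP (th t) (tau t); first by rewrite xt// !mul0r.
    by rewrite ler_wpM2l// le_max bt orbT.
  rewrite le_eqVlt; apply/orP; left; apply/eqP; apply: ae_eq_integral => //.
  - by apply/measurable_EFinP; exact: measurable_funTS.
  - by apply/measurable_EFinP; exact: measurable_funTS.
  apply: ae_imply xBad => t xt _; congr EFin.
  have [tb|bt] := ltP (th t) (tau t); first by rewrite xt// !mul0r.
  by congr (_ * _); apply/max_idPr; exact: le_trans (tau0 t) bt.
exists u, v; split => //.
- by rewrite mulrDr ru rv /T; lra.
- by apply: le_trans revE _; rewrite lee_fin.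
move=> Dgt revV; rewrite -subr_gt0 -/D in Dgt.
have xV : \int[mu]_(t in `[lo, hi]) (x t * th t) = window_revenue k r e L D T u v.
  by apply/le_anti; rewrite Vle -lee_fin -revV revE.
have xW := Veq Dgt xV.
have W : b - u < a + v.
  have : 0 <= (1 - r) * (u + v) by apply: mulr_ge0; lra.
  have : r * (u + v) = b - t1 m + (t2 m - a) by rewrite mulrDr ru rv.
  by move: T0; rewrite /T; lra.
apply: (full_capacity_window hm free fea W _ _ _ _ xW) => //.
Qed.

(** * An equilibrium attaining the bound *)

(** First-order conditions equate the marginal penalties, [e * u = L * v = c], with
    [c = D * (1 - r)] unless the constraint binds, in which case [r * (u + v) = T] fixes [c]. The
    bounds by [D] keep the cap nonnegative on the window. *)
Lemma optimal_window {R : realType} (k r e L D T : R) :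
  0 < k -> 0 < r -> r < 1 -> 0 < e -> 0 < L -> 0 <= D -> 0 < T ->
  exists u v, [/\ 0 <= u, 0 <= v, r * (u + v) <= T, e * u <= D /\ L * v <= D &
    forall u' v', 0 <= u' -> 0 <= v' -> r * (u' + v') <= T ->
      window_revenue k r e L D T u' v' <= window_revenue k r e L D T u v].
Proof.
move=> k0 r0 r1 e0 L0 D0 T0.
pose h := e^-1 + L^-1.
have h0 : 0 < h by rewrite addr_gt0 ?invr_gt0.
pose c := Num.min (D * (1 - r)) (T / (r * h)).
have c0 : 0 <= c by rewrite le_min mulr_ge0 ?divr_ge0 ?mulr_ge0 ?subr_ge0// ltW.
have cD : c <= D * (1 - r) by rewrite ge_min lexx.
have cT : r * (c * h) <= T.
  have : c <= T / (r * h) by rewrite ge_min lexx orbT.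
  by rewrite ler_pdivlMr ?mulr_gt0//; lra.
have eu : e * (c / e) = c by rewrite mulrC divfK// gt_eqF.
have Lv : L * (c / L) = c by rewrite mulrC divfK// gt_eqF.
have uvE : c / e + c / L = c * h by rewrite -mulrDr.
exists (c / e), (c / L); split.
- by rewrite divr_ge0// ltW.
- by rewrite divr_ge0// ltW.
- by rewrite uvE.
- by rewrite eu Lv; split; nra.
move=> u' v' u'0 v'0 uvT; rewrite /window_revenue ler_pM2l//.
set u := c / e in eu uvE *; set v := c / L in Lv uvE *.
(* concavity: the gain is at most its linearization at the optimum *)
have key : (D * (1 - r) - c) * (u' + v' - (u + v)) <= 0.
  have [cE|cE] := leP (D * (1 - r)) (T / (r * h)).
    have -> : c = D * (1 - r) by apply/min_idPl.
    by rewrite subrr mul0r.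
  have cE' : c = T / (r * h) by apply/min_idPr; exact: ltW.
  have : r * (u + v) = T.
    by rewrite uvE cE'; field; rewrite !gt_eqF.
  move=> ruv; apply: mulr_ge0_le0; first by rewrite subr_ge0.
  by rewrite subr_le0 -(ler_pM2l r0) ruv.
have s1 : 0 <= e * (u' - u) ^+ 2 by rewrite mulr_ge0 ?sqr_ge0 ?ltW.
have s2 : 0 <= L * (v' - v) ^+ 2 by rewrite mulr_ge0 ?sqr_ge0 ?ltW.
have t1_ : e * (u' - u) ^+ 2 = e * u' ^+ 2 - 2 * (e * u) * u' + (e * u) * u by ring.
have t2_ : L * (v' - v) ^+ 2 = L * v' ^+ 2 - 2 * (L * v) * v' + (L * v) * v by ring.
rewrite t1_ eu in s1; rewrite t2_ Lv in s2.
have q1 : e * u ^+ 2 = c * u by rewrite -eu; ring.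
have q2 : L * v ^+ 2 = c * v by rewrite -Lv; ring.
rewrite q1 q2; lra.
Qed.

Lemma lebesgue_measure_itv_cc {R : realType} (p q : R) :
  mu (`[p, q] : set R) = (Num.max 0 (q - p))%:E.
Proof.
rewrite lebesgue_measure_itv/= lte_fin; case: ltP => pq.
  by rewrite -EFinB; congr EFin; apply/esym/max_idPr; lra.
by congr EFin; apply/esym/max_idPl; lra.
Qed.

Lemma delay_free_flow {R : realType} (m : urban_model R) (n : R) :
  standing_assumptions m -> free_flow_below_critical m ->
  n = n_c m \/ n = 0 -> delay m n = 0%E.
Proof.
move=> hm free [->|->]; rewrite /delay; last by rewrite eqxx.
have nc := n_c_gt0 hm; have mf := mu_f_gt0 hm.
have -> : mfd m (n_c m) = mu_f m.
  by rewrite free ?divff ?mulr1 ?gt_eqF// lexx ltW.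
by rewrite !gt_eqF// subrr.
Qed.

(** Desired times before [b] and after [a] are stretched away from these points by the factor
    [1 / r], which thins the desired rate to capacity; in between exits are on time. *)
Definition window_exit_time {R : realType} (r b a s : R) : R :=
  s - (r^-1 - 1) * Num.max 0 (b - s) + (r^-1 - 1) * Num.max 0 (s - a).

(** The inverse map, contracting by [r]: it gives the desired time served at [t]. *)
Definition window_user {R : realType} (r b a t : R) : R :=
  t + (1 - r) * Num.max 0 (b - t) - (1 - r) * Num.max 0 (t - a).

Lemma pospart_id {R : realType} (z : R) : 0 <= z -> Num.max 0 z = z.
Proof. by move=> z0; apply/max_idPr. Qed.

Lemma pospart_eq0 {R : realType} (z : R) : z <= 0 -> Num.max 0 z = 0.
Proof. by move=> z0; apply/max_idPl. Qed.

Lemma window_exit_time_mono {R : realType} (r b a : R) : 0 < r -> r < 1 ->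
  {mono window_exit_time r b a : s s' / s <= s'}.
Proof.
move=> r0 r1; apply: le_mono => s s' ss'; rewrite /window_exit_time.
have c0 : 0 <= r^-1 - 1 by rewrite subr_ge0 invf_ge1// ltW.
have h (z z' : R) : z <= z' -> (r^-1 - 1) * Num.max 0 z <= (r^-1 - 1) * Num.max 0 z'.
  move=> zz'; rewrite ler_wpM2l// ge_max !le_max lexx/= zz' orbT//.
have := h (b - s') (b - s); have := h (s - a) (s' - a); lra.
Qed.

Lemma window_userK {R : realType} (r b a : R) : 0 < r -> r < 1 -> b <= a ->
  cancel (window_user r b a) (window_exit_time r b a).
Proof.
move=> r0 r1 ba t; rewrite /window_exit_time /window_user.
have r'0 : r != 0 by rewrite gt_eqF.
have [tb|bt] := ltP t b.
  have h : 0 < r * (b - t) by rewrite mulr_gt0// subr_gt0.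
  rewrite (@pospart_id _ (b - t)); last lra.
  rewrite (@pospart_eq0 _ (t - a)); last lra.
  rewrite pospart_id; last lra.
  rewrite pospart_eq0; last lra.
  by field.
have [ta|at_] := leP t a.
  rewrite (@pospart_eq0 _ (b - t)); last lra.
  rewrite (@pospart_eq0 _ (t - a)); last lra.
  rewrite pospart_eq0; last lra.
  rewrite pospart_eq0; last lra.
  by ring.
have h : 0 < r * (t - a) by rewrite mulr_gt0// subr_gt0.
rewrite (@pospart_eq0 _ (b - t)); last lra.
rewrite (@pospart_id _ (t - a)); last lra.
rewrite pospart_eq0; last lra.
rewrite pospart_id; last lra.
by field.
Qed.

Lemma window_exit_time_le {R : realType} (r b a s t : R) :
  0 < r -> r < 1 -> b <= a ->
  (window_exit_time r b a s <= t) = (s <= window_user r b a t).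
Proof.
move=> r0 r1 ba.
by rewrite -{1}(window_userK r0 r1 ba t) window_exit_time_mono.
Qed.

Lemma integral_const_itv {R : realType} (k p q : R) :
  (\int[mu]_(t in `[p, q]) k%:E = (k * Num.max 0 (q - p))%:E)%E.
Proof.
rewrite integral_cst// EFinM; congr (_ * _)%E.
exact: lebesgue_measure_itv_cc.
Qed.

Lemma integral_window_rate {R : realType} (k p q t : R) :
  (\int[mu]_(y in `]-oo, t]) (k * \1_(`[p, q] : set R) y)%:E =
   (k * Num.max 0 (Num.min t q - p))%:E)%E.
Proof.
rewrite -integral_const_itv.
have -> : `[p, Num.min t q]%classic = `]-oo, t] `&` `[p, q]%classic :> set R.
  apply/seteqP; split => y /=; rewrite !in_itv/= le_min.
    by move=> /and3P[-> -> ->].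
  by move=> [-> /andP[-> ->]].
rewrite [RHS]integral_mkcondr; apply: eq_integral => y _.
rewrite indicE patchE; case: ifP => _; by rewrite ?mulr1 ?mulr0.
Qed.

Lemma integral_window_share {R : realType} (l r b a s0 w : R) :
  s0 <= b -> b <= a ->
  (\int[mu]_(s in `[s0, w]) (l * (1 - (1 - r) * \1_(`[b, a] : set R) s))%:E =
   (l * (Num.max 0 (w - s0) - (1 - r) * Num.max 0 (Num.min w a - b)))%:E)%E.
Proof.
move=> s0b ba.
have Bc c := bounded_measurable_cst s0 w c.
have Bi : bounded_measurable s0 w (\1_(`[b, a] : set R)).
  exact: bounded_measurable_indic.
have Bri := bounded_measurableM (Bc (1 - r)) Bi.
have Bs := bounded_measurableB (Bc 1) Bri.
have I := bounded_measurable_integrable.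
have Is := I _ _ _ _ Bs.
have Ils := I _ _ _ _ (bounded_measurableM (Bc l) Bs).
rewrite -[LHS]fineK; last exact: integrable_fin_num Ils.
congr EFin; rewrite -/(Rintegral mu `[s0, w] _).
rewrite RintegralZl//; congr (l * _).
rewrite RintegralB//; [|exact: I (Bc 1)|exact: I Bri].
rewrite RintegralZl//; last exact: I Bi.
congr (_ - _ * _).
  by rewrite /Rintegral integral_const_itv mul1r.
rewrite /Rintegral integral_indic//.
have -> : `[b, a] `&` `[s0, w] = `[b, Num.min w a]%classic :> set R.
  apply/seteqP; split => y /=; rewrite !in_itv/= le_min.
    by move=> [/andP[-> ->] /andP[_ ->]].
  by move=> /and3P[by_ -> ->]; rewrite by_ (le_trans s0b).
exact: (congr1 fine (lebesgue_measure_itv_cc _ _)).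
Qed.

(* Each side counts the users who exit by time [t]: all of them before [b] and
   after [a], the share [r] in between. *)
Lemma window_balance {R : realType} (l r b a u v s1 s2 t : R) :
  0 < r -> r < 1 -> b <= a -> 0 <= u -> 0 <= v ->
  b = s1 + r * u -> a = s2 - r * v ->
  let w := Num.min s2 (window_user r b a t) in
  l * (Num.max 0 (w - s1) - (1 - r) * Num.max 0 (Num.min w a - b)) =
  r * l * Num.max 0 (Num.min t (a + v) - (b - u)).
Proof.
move=> r0 r1 ba u0 v0 bE aE w.
have ru : 0 <= r * u by apply: mulr_ge0; lra.
have rv : 0 <= r * v by apply: mulr_ge0; lra.
rewrite (mulrC r l) -mulrA; congr (l * _).
have [tb|bt] := ltP t b.
  have wE : w = b - r * (b - t).
    rewrite /w /window_user pospart_id ?pospart_eq0; [|lra..].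
    have : 0 <= r * (b - t) by apply: mulr_ge0; lra.
    by move=> h; rewrite (_ : Num.min _ _ = t + (1 - r) * (b - t) - (1 - r) * 0); [ring|apply/min_idPr; lra].
  have h : 0 <= r * (b - t) by apply: mulr_ge0; lra.
  rewrite (_ : Num.min w a = w); last by apply/min_idPl; lra.
  rewrite (_ : Num.min t (a + v) = t); last by apply/min_idPl; lra.
  rewrite (@pospart_eq0 _ (w - b)); last lra.
  have [tp|pt] := ltP t (b - u).
    have h2 : r * u <= r * (b - t) by rewrite ler_pM2l//; lra.
    by rewrite !pospart_eq0; [ring|lra..].
  have h2 : r * (b - t) <= r * u by rewrite ler_pM2l//; lra.
  rewrite !pospart_id; [|lra..].
  by rewrite wE bE; ring.
have [ta|at_] := leP t a.
  have wE : w = t.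
    rewrite /w /window_user !pospart_eq0; [|lra..].
    by rewrite !mulr0 addr0 subr0; apply/min_idPr; lra.
  rewrite wE (_ : Num.min t a = t); last by apply/min_idPl; lra.
  rewrite (_ : Num.min t (a + v) = t); last by apply/min_idPl; lra.
  rewrite !pospart_id; [|lra..].
  by rewrite {1}(_ : s1 = b - r * u); [ring|lra].
have [tq|qt] := leP t (a + v).
  have h : r * (t - a) <= r * v by rewrite ler_pM2l//; lra.
  have h0 : 0 <= r * (t - a) by apply: mulr_ge0; lra.
  have wE : w = a + r * (t - a).
    rewrite /w /window_user pospart_eq0 ?pospart_id; [|lra..].
    by rewrite (_ : Num.min _ _ = t + (1 - r) * 0 - (1 - r) * (t - a)); [ring|apply/min_idPr; lra].
  rewrite wE (_ : Num.min (a + _) a = a); last by apply/min_idPr; lra.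
  rewrite !pospart_id; [|lra..].
  by rewrite {1}(_ : s1 = b - r * u); [ring|lra].
have h : r * v <= r * (t - a) by rewrite ler_pM2l//; lra.
have wE : w = s2.
  rewrite /w /window_user pospart_eq0 ?pospart_id; [|lra..].
  by apply/min_idPl; lra.
rewrite wE (_ : Num.min s2 a = a); last by apply/min_idPr; lra.
rewrite !pospart_id; [|lra..].
by rewrite {1}(_ : s1 = b - r * u) 1?{1}(_ : s2 = a + r * v); [ring|lra..].
Qed.

Definition window_outcome {R : realType} (m : urban_model R) (r b a u v : R)
    : outcome R :=
  Outcome (fun t => n_c m * \1_(`[b - u, a + v] : set R) t)
    (fun s => 1 - (1 - r) * \1_(`[b, a] : set R) s)
    (window_exit_time r b a) (b - u) (a + v).

Lemma pospart_addr_le {R : realType} (x y z : R) :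
  Num.max 0 (x - z) <= Num.max 0 (x - y) + Num.max 0 (y - z).
Proof.
case: (maxr_case (x - y)) => -[? ->]; case: (maxr_case (y - z)) => -[? ->];
  by case: (maxr_case (x - z)) => -[? ->]; lra.
Qed.

(** The slopes of the cap never exceed the schedule penalties, so leaving [s] for a cheaper exit
    cannot pay. *)
Lemma toll_cap_sched_le {R : realType} (e L D b a t s : R) : 0 < e -> 0 < L ->
  toll_cap e L D b a s <= toll_cap e L D b a t + sched e L t s.
Proof.
move=> e0 L0; rewrite /toll_cap /sched.
have := ler_wpM2l (ltW e0) (pospart_addr_le b s t).
have := ler_wpM2l (ltW L0) (pospart_addr_le t s a).
by rewrite !mulrDr; lra.
Qed.

(** The stretched exit moves away from [b] or [a], where the cap falls exactly as fast as the
    penalty grows: the preceding bound is attained. *)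
Lemma window_exit_time_cost {R : realType} (e L D r b a s : R) :
  0 < r -> r < 1 -> b <= a ->
  let t := window_exit_time r b a s in
  toll_cap e L D b a t + sched e L t s = toll_cap e L D b a s.
Proof.
move=> r0 r1 ba t.
have c0 : 0 <= r^-1 - 1 by rewrite subr_ge0 invf_ge1// ltW.
rewrite /toll_cap /sched.
have [sb|bs] := ltP s b.
  have tE : t = s - (r^-1 - 1) * (b - s).
    rewrite /t /window_exit_time (@pospart_id _ (b - s)); last lra.
    by rewrite pospart_eq0 ?mulr0 ?addr0//; lra.
  have h : 0 <= (r^-1 - 1) * (b - s) by apply: mulr_ge0; lra.
  rewrite (@pospart_id _ (b - t)); last lra.
  rewrite (@pospart_id _ (b - s)); last lra.
  rewrite (@pospart_id _ (s - t)); last lra.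
  rewrite (@pospart_eq0 _ (t - a)); last lra.
  rewrite (@pospart_eq0 _ (s - a)); last lra.
  rewrite (@pospart_eq0 _ (t - s)); last lra.
  by ring.
have [sa|as_] := leP s a.
  have tE : t = s.
    by rewrite /t /window_exit_time !pospart_eq0 ?mulr0 ?addr0 ?subr0//; lra.
  by rewrite tE subrr maxxx !mulr0 !addr0.
have tE : t = s + (r^-1 - 1) * (s - a).
  rewrite /t /window_exit_time (@pospart_id _ (s - a)); last lra.
  by rewrite pospart_eq0 ?mulr0 ?subr0//; lra.
have h : 0 <= (r^-1 - 1) * (s - a) by apply: mulr_ge0; lra.
rewrite (@pospart_eq0 _ (b - t)); last lra.
rewrite (@pospart_eq0 _ (b - s)); last lra.
rewrite (@pospart_eq0 _ (s - t)); last lra.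
rewrite (@pospart_id _ (t - a)); last lra.
rewrite (@pospart_id _ (s - a)); last lra.
rewrite (@pospart_id _ (t - s)); last lra.
by ring.
Qed.

(* Early users fill [b - u, b] and late users [a, a + v] at capacity; [r] is the
   ratio of capacity to desired rate. *)
Record capacity_window {R : realType} (m : urban_model R) (r b a u v : R)
    : Prop := CapacityWindow {
  cw_r0 : 0 < r;
  cw_r1 : r < 1;
  cw_cap : mu_f m = r * desired_rate m;
  cw_u0 : 0 <= u;
  cw_v0 : 0 <= v;
  cw_ba : b <= a;
  cw_b : b = t1 m + r * u;
  cw_a : a = t2 m - r * v
}.

Lemma window_AD {R : realType} (m : urban_model R) (r b a u v : R) :
  standing_assumptions m -> capacity_window m r b a u v -> b - u < a + v.
Proof.
move=> hm [r0 r1 kE u0 v0 ba bE aE].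
have := t1_lt_t2 hm.
have : 0 <= (1 - r) * u by apply: mulr_ge0; lra.
have : 0 <= (1 - r) * v by apply: mulr_ge0; lra.
have : 0 <= r * u by apply: mulr_ge0; lra.
have : 0 <= r * v by apply: mulr_ge0; lra.
by lra.
Qed.

Lemma window_accumulation {R : realType} (m : urban_model R) (r b a u v t : R) :
  accumulation (window_outcome m r b a u v) t =
  (if b - u <= t <= a + v then n_c m else 0).
Proof. by rewrite /= indic_itv in_itv/=; case: ifP; rewrite ?mulr1 ?mulr0. Qed.

Lemma window_exit_rate {R : realType} (m : urban_model R) (r b a u v t : R) :
  standing_assumptions m -> free_flow_below_critical m ->
  exit_rate m (window_outcome m r b a u v) t = mu_f m * \1_(`[b - u, a + v] : set R) t.
Proof.
move=> hm free; have nc := n_c_gt0 hm.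
rewrite /exit_rate window_accumulation indic_itv in_itv/=; case: ifP => _.
  by rewrite free ?divff ?gt_eqF// lexx ltW.
by rewrite free ?mul0r// lexx ltW.
Qed.

Lemma window_share {R : realType} (m : urban_model R) (r b a u v s : R) :
  car_share (window_outcome m r b a u v) s = if b <= s <= a then r else 1.
Proof.
by rewrite /= indic_itv in_itv/=; case: ifP => _; rewrite ?mulr1 ?mulr0; ring.
Qed.

Lemma window_feasible {R : realType} (m : urban_model R) (r b a u v : R) :
  standing_assumptions m -> free_flow_below_critical m ->
  capacity_window m r b a u v ->
  feasible m (window_outcome m r b a u v).
Proof.
move=> hm free w; have AD := window_AD hm w; have mf0 := mu_f_gt0 hm.
have rate_in p q : b - u <= p -> q <= a + v -> p < q ->
    (0 < \int[mu]_(x in `[p, q]) (exit_rate m (window_outcome m r b a u v) x)%:E)%E.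
  move=> bp qa pq.
  have -> : (\int[mu]_(x in `[p, q]) (exit_rate m (window_outcome m r b a u v) x)%:E =
      \int[mu]_(x in `[p, q]) (mu_f m)%:E)%E.
    apply: eq_integral => x /set_mem/=; rewrite in_itv/= => /andP[px xq].
    congr EFin; rewrite window_exit_rate// indic_itv in_itv/=.
    by rewrite (le_trans bp px) (le_trans xq qa) mulr1.
  rewrite integral_const_itv lte_fin mulr_gt0// pospart_id; lra.
case: w => r0 r1 kE u0 v0 ba bE aE.
split.
- by move=> t; rewrite window_accumulation; case: ifP => // _; rewrite ltW ?(n_c_gt0 hm).
- exact: ltW.
- by move=> t /negP h; rewrite window_accumulation (negbTE h).
- rewrite (_ : exit_rate m (window_outcome m r b a u v) = fun t => mu_f m * \1_(`[b - u, a + v] : set R) t).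
    by apply: measurable_funM => //; exact: measurable_indic.
  by apply/funext => t; rewrite window_exit_rate//.
- by move=> t /andP[At tD]; apply: rate_in => //; exact: ltW.
- by move=> t /andP[At tD]; apply: rate_in => //; exact: ltW.
- by move=> s _; rewrite window_share; case: ifP => _; rewrite ?ler01 ?lexx ?ltW.
- apply: measurable_funTS; apply: measurable_funB => //.
  by apply: measurable_funM => //; exact: measurable_indic.
- move=> s s' _ _ _ _ /ltW; by rewrite /= window_exit_time_mono.
- move=> t.
  rewrite (_ : exited_by m (window_outcome m r b a u v) t =
    `[t1 m, Num.min (t2 m) (window_user r b a t)]%classic).
    rewrite integral_window_share//; last by rewrite bE lerDl mulr_ge0// ltW.
    rewrite (window_balance _ _ r0 r1 ba u0 v0 bE aE) -kE -integral_window_rate.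
    by apply: eq_integral => x _; rewrite window_exit_rate//.
  apply/seteqP; split => s; rewrite /exited_by /= in_itv/= le_min.
    by move=> [/andP[-> ->] _]; rewrite window_exit_time_le.
  move=> /and3P[-> -> h]; split => //; first by have /= -> := window_share m r b a u v s; case: ifP.
  by rewrite window_exit_time_le.
Qed.

(** Truncation makes this an admissible toll. It can only raise the cap, so deviations stay
    unprofitable. *)
Definition window_toll {R : realType} (m : urban_model R) (b a t : R) : R :=
  Num.max 0 (toll_cap (earliness m) (lateness m) (z_T m - z_C m) b a t).

Lemma window_toll_cap_ge0 {R : realType} (e L D b a u v t : R) :
  0 < e -> 0 < L -> 0 <= u -> b <= a -> e * u <= D -> L * v <= D ->
  b - u <= t <= a + v -> 0 <= toll_cap e L D b a t.
Proof.
move=> e0 L0 u0 ba eu Lv /andP[bt ta].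
have D0 : 0 <= D by apply: le_trans eu; rewrite mulr_ge0// ltW.
rewrite /toll_cap.
have [tb|tb] := leP b t; last first.
  rewrite (@pospart_eq0 _ (t - a)); last lra.
  rewrite pospart_id ?mulr0 ?subr0 ?subr_ge0; last lra.
  by apply: le_trans eu; rewrite ler_pM2l//; lra.
rewrite pospart_eq0 ?mulr0 ?subr0; last lra.
have [ta'|ta'] := leP t a; first by rewrite pospart_eq0 ?mulr0 ?subr0//; lra.
rewrite pospart_id ?subr_ge0; last lra.
by apply: le_trans Lv; rewrite ler_pM2l//; lra.
Qed.

Lemma toll_window_toll {R : realType} (m : urban_model R) (b a : R) :
  toll (window_toll m b a).
Proof.
split; last by move=> t; rewrite le_max lexx.
apply: measurable_maxr => //.
by case: (bounded_measurable_toll_cap (earliness m) (lateness m) (z_T m - z_C m) b a 0 0).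
Qed.

Lemma window_cost {R : realType} (m : urban_model R) (r b a u v t s : R) (tau : R -> R) :
  standing_assumptions m -> free_flow_below_critical m ->
  cost m tau (window_outcome m r b a u v) t s =
  (z_C m + (tau t + sched (earliness m) (lateness m) t s))%:E.
Proof.
move=> hm free.
rewrite /cost delay_free_flow//; last first.
  by rewrite window_accumulation; case: ifP; [left|right].
by rewrite adde0; apply: (congr1 EFin); rewrite /sched; lra.
Qed.

Lemma window_equilibrium {R : realType} (m : urban_model R) (r b a u v : R) :
  standing_assumptions m -> free_flow_below_critical m ->
  capacity_window m r b a u v ->
  earliness m * u <= z_T m - z_C m -> lateness m * v <= z_T m - z_C m ->
  equilibrium m (window_toll m b a) (window_outcome m r b a u v).
Proof.
move=> hm free w eu Lv; have fea := window_feasible hm free w.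
case: w => r0 r1 kE u0 v0 ba bE aE.
pose e := earliness m; pose L := lateness m; pose D := z_T m - z_C m.
pose o := window_outcome m r b a u v; pose th := toll_cap e L D b a.
pose tau := window_toll m b a.
have e0 : 0 < e := earliness_gt0 hm; have L0 : 0 < L := lateness_gt0 hm.
have costge t s : z_C m + th s <= z_C m + (tau t + sched e L t s).
  rewrite lerD2l; apply: (le_trans (toll_cap_sched_le D b a t s e0 L0)).
  by rewrite lerD2r le_max lexx orbT.
have exit_in s : t1 m <= s <= t2 m -> b - u <= exit_time o s <= a + v.
  have ru : 0 <= r * u by rewrite mulr_ge0// ltW.
  have rv : 0 <= r * v by rewrite mulr_ge0// ltW.
  move=> /andP[s1 s2]; apply/andP; split.
    rewrite -(window_userK r0 r1 ba (b - u)) /= window_exit_time_mono//.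
    rewrite /window_user pospart_id ?pospart_eq0; [|lra..].
    by apply: le_trans s1; lra.
  rewrite /= window_exit_time_le// /window_user pospart_eq0 ?pospart_id; [|lra..].
  by apply: (le_trans s2); lra.
have costE s : t1 m <= s <= t2 m ->
    cost m tau o (exit_time o s) s = (z_C m + th s)%:E.
  move=> st; rewrite window_cost// /tau /window_toll pospart_id; last first.
    exact: (window_toll_cap_ge0 e0 L0 u0 ba eu Lv (exit_in s st)).
  by rewrite /th window_exit_time_cost.
split.
- exact: fea.
- by move=> s st _ t; rewrite costE// window_cost// lee_fin.
- move=> s st _; rewrite costE// lee_fin -lerBrDl -/D /th /toll_cap.
  have p0 (y z : R) : 0 < y -> 0 <= y * Num.max 0 z.
    by move=> y0; rewrite mulr_ge0 ?le_max ?lexx// ltW.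
  by have := p0 e (b - s) e0; have := p0 L (s - a) L0; lra.
(* Transit is used only for desired times in [[b, a]], where the cap equals [D] and every exit costs
   at least [z_T]. *)
- move=> s st; rewrite window_share; case: ifP; last by rewrite ltxx.
  move=> /andP[bs sa] _ t; rewrite window_cost// lee_fin.
  apply: le_trans (costge t s); rewrite /th /toll_cap !pospart_eq0 ?mulr0 ?subr0; [|lra..].
  by rewrite /D; lra.
Qed.

Lemma window_outcome_revenue {R : realType} (m : urban_model R) (r b a u v : R) :
  standing_assumptions m -> free_flow_below_critical m ->
  capacity_window m r b a u v ->
  earliness m * u <= z_T m - z_C m -> lateness m * v <= z_T m - z_C m ->
  outcome_revenue m (window_toll m b a) (window_outcome m r b a u v) =
  (window_revenue (mu_f m) r (earliness m) (lateness m) (z_T m - z_C m)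
     (t2 m - t1 m) u v)%:E.
Proof.
move=> hm free [r0 r1 kE u0 v0 ba bE aE] eu Lv.
set e := earliness m in eu *; set L := lateness m in Lv *.
set D := z_T m - z_C m in eu Lv *; pose th := toll_cap e L D b a.
rewrite /outcome_revenue /=.
transitivity (\int[mu]_(t in `[(b - u)%R, (a + v)%R]) (mu_f m * th t)%:E)%E.
  apply: eq_integral => t /set_mem/=; rewrite in_itv/= => tW; congr EFin.
  rewrite window_exit_rate// indic_itv in_itv/= tW mulr1 /window_toll pospart_id//.
  exact: (window_toll_cap_ge0 (earliness_gt0 hm) (lateness_gt0 hm) u0 ba eu Lv tW).
have Bth := bounded_measurable_toll_cap e L D b a (b - u) (a + v).
have Ik := bounded_measurable_integrable
  (bounded_measurableM (bounded_measurable_cst (b - u) (a + v) (mu_f m)) Bth).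
rewrite -[LHS]fineK; last exact: integrable_fin_num Ik.
congr EFin; rewrite -/(Rintegral mu `[b - u, a + v] _).
rewrite RintegralZl//; last exact: bounded_measurable_integrable Bth.
rewrite Rintegral_toll_cap// /window_revenue; congr (_ * (D * _ - _)).
by rewrite bE aE; ring.
Qed.

(** * Conclusion *)

(** Every neighbourhood of [t] meets [[p, q]] in a nondegenerate interval, even at an endpoint,
    hence contains points where [f] equals [c]. *)
Lemma ae_cst_continuous_within {R : realType} (f : R -> R) (p q c t : R) :
  p < q -> {ae mu, forall y, p <= y <= q -> f y = c} ->
  p <= t <= q -> f x @[x --> within `[p, q] (nbhs t)] --> f t -> f t = c.
Proof.
move=> pq fc /andP[pt tq] ft; apply/eqP; rewrite -subr_eq0 -normr_le0.
apply/ler_addgt0Pr => eps eps0; rewrite add0r.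
have /cvgrPdist_lt/(_ _ eps0) := ft.
rewrite near_withinE => /nbhs_ballP[d /= d0 fd].
have lo : Num.max p (t - d) < Num.min q (t + d).
  by rewrite lt_min !gt_max pq/=; apply/and3P; split; lra.
have [y] := ae_itv_ex fc lo.
rewrite lt_min gt_max => /andP[/andP[py ty] /andP[yq yt]] fy.
have pyq : p <= y <= q by rewrite !ltW.
rewrite -(fy pyq) ltW//; apply: fd; last by rewrite /= in_itv.
by rewrite /ball/= ltr_norml; apply/andP; split; lra.
Qed.

(** Rigidity is claimed for [z_C < z_T]: with equal costs the best revenue is 0, and attaining it
    says nothing about exits. As revenue sees the exit rate only up to null sets, pointwise values
    are recovered where the accumulation is continuous along the exit interval. *)
Theorem theorem4 (R : realType) (m : urban_model R)
    (hm : standing_assumptions m)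
    (hcap : mu_f m < desired_rate m)
    (hmfd1 : congested_beyond_critical m)
    (hmfd2 : free_flow_below_critical m)
    (hz : z_C m <= z_T m) :
  (exists (tau : R -> R) (o : outcome R),
     [/\ revenue_optimal m tau,
         tie_broken_equilibrium m tau o,
         t_A o < t_D o &
         forall t, t_A o <= t <= t_D o ->
           accumulation o t = n_c m /\ exit_rate m o t = mu_f m])
  /\
  (z_C m < z_T m ->
   forall (tau : R -> R) (o : outcome R),
     revenue_optimal m tau -> tie_broken_equilibrium m tau o ->
     [/\ t_A o < t_D o,
         {ae (@lebesgue_measure R), forall t, t_A o <= t <= t_D o ->
            accumulation o t = n_c m /\ exit_rate m o t = mu_f m} &
         forall t, t_A o <= t <= t_D o ->
           accumulation o x @[x --> within `[t_A o, t_D o] (nbhs t)]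
             --> accumulation o t ->
           accumulation o t = n_c m /\ exit_rate m o t = mu_f m]).
Proof.
have mf0 := mu_f_gt0 hm; have l0 := desired_rate_gt0 hm.
pose r := mu_f m / desired_rate m.
have r0 : 0 < r by rewrite divr_gt0.
have r1 : r < 1 by rewrite ltr_pdivrMr// mul1r.
have D0 : 0 <= z_T m - z_C m by rewrite subr_ge0.
have T0 : 0 < t2 m - t1 m by rewrite subr_gt0 (t1_lt_t2 hm).
have [u [v [u0 v0 uvT [eu Lv] uv_opt]]] :=
  optimal_window mf0 r0 r1 (earliness_gt0 hm) (lateness_gt0 hm) D0 T0.
set W := window_revenue in uv_opt.
set V := W (mu_f m) r _ _ _ _ u v in uv_opt.
have rev_le tau o : toll tau -> equilibrium m tau o ->
    (outcome_revenue m tau o <= V%:E)%E.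
  move=> htau eqo.
  have [u' [v' [u'0 v'0 uv'T le_V _]]] :=
    equilibrium_revenue_le hm hmfd1 hmfd2 hcap hz htau eqo.
  by apply: (le_trans le_V); rewrite lee_fin uv_opt.
have revenue_le tau : toll tau -> (revenue m tau <= V%:E)%E.
  by move=> htau; apply: ge_ereal_sup => _ [oc eqo <-]; exact: rev_le.
pose b := t1 m + r * u; pose a := t2 m - r * v.
have w : capacity_window m r b a u v.
  split=> //; first by rewrite divfK// gt_eqF.
  by move: uvT; rewrite /a /b mulrDr; lra.
pose tau0 := window_toll m b a; pose o0 := window_outcome m r b a u v.
have htau0 : toll tau0 := toll_window_toll m b a.
have eqo0 : equilibrium m tau0 o0 := window_equilibrium hm hmfd2 w eu Lv.
have rev0 : outcome_revenue m tau0 o0 = V%:E :=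
  window_outcome_revenue hm hmfd2 w eu Lv.
have revenue0 : revenue m tau0 = V%:E.
  apply/le_anti; rewrite revenue_le//= -rev0.
  by apply: ereal_sup_ubound; exists o0.
split.
  exists tau0, o0; split.
  - by split => // tau htau; rewrite revenue0 revenue_le.
  - by split => //; rewrite revenue0.
  - exact: window_AD hm w.
  - move=> t tW; have tW' : b - u <= t <= a + v := tW.
    rewrite window_accumulation tW' window_exit_rate// indic_itv in_itv/= tW'.
    by rewrite mulr1.
move=> hlt tau o [htau opt] [eqo revo].
(* Optimality against [tau0] gives at least [V], the general bound at most [V]; the window
   [(u', v')] of this equilibrium is then also optimal, and equality in the bathtub bound forces
   full capacity. *)
have revV : outcome_revenue m tau o = V%:E.
  by apply/le_anti; rewrite rev_le//= revo -revenue0 opt.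
have [u' [v' [u'0 v'0 uv'T le_V full]]] :=
  equilibrium_revenue_le hm hmfd1 hmfd2 hcap hz htau eqo.
have V'E : V = W (mu_f m) r (earliness m) (lateness m) (z_T m - z_C m)
    (t2 m - t1 m) u' v'.
  by apply/le_anti; rewrite uv_opt// andbT -lee_fin -revV.
have [AD full_rate] : t_A o < t_D o /\ {ae mu, forall t,
    t_A o <= t <= t_D o -> exit_rate m o t = mu_f m}.
  by apply: full => //; rewrite revV V'E.
have acc_n_c t : exit_rate m o t = mu_f m -> accumulation o t = n_c m.
  by have [_] := mfd_le hm hmfd1 hmfd2 (fl_acc_ge0 (eq_feasible eqo) t).
have rate_n_c t : accumulation o t = n_c m -> exit_rate m o t = mu_f m.
  move=> at_; have nc := n_c_gt0 hm.
  by rewrite /exit_rate at_ hmfd2 ?divff ?mulr1 ?gt_eqF// lexx ltW.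
split => //.
  by apply: ae_imply full_rate => t ft /ft xt; split => //; exact: acc_n_c.
move=> t tAD acc_cvg.
have at_ : accumulation o t = n_c m.
  apply: (ae_cst_continuous_within AD _ tAD acc_cvg).
  by apply: ae_imply full_rate => y fy /fy; exact: acc_n_c.
by split => //; exact: rate_n_c.
Qed.
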